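(* Let $\Bbbk$ be a field of characteristic $2$ and let $n\ge4$. Let $m_3:C_{n-1}^{\otimes3}\to C_{n-1}$ be the degree $-1$ linear map given on the path basis by \begin{align*} m_3\big((i|i+1),(i+1|i),(i|i+1|i)\big)&=(i|i+1|i) && (1\le i\le n-2),\\ m_3\big((i-1|i),(i|i-1),(i-1|i)\big)&=(i-1|i) && (2\le i\le n-1),\\ m_3\big((i|i+1|i),(i|i-1),(i-1|i)\big)&=(i|i+1|i) && (2\le i\le n-1), \end{align*} and zero on all other triples of path basis elements. Then $m_3$ is not a Hochschild coboundary: there is no $m\in C^2(C_{n-1},C_{n-1})^{-1}$ with $\delta m=m_3$. Consequently the cocycle $m_3$ determines a non-trivial class in the Hochschild cohomology group $\mathrm{HH}^3(C_{n-1},C_{n-1})^{-1}$.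
   Context: **Zigzag algebra.** Let $Q_n$ be the quiver with vertices $1,\dots,n$ and exactly one arrow $i\to i+1$ and one arrow $i+1\to i$ for each $1\le i\le n-1$. A path through neighbouring vertices $i_1,\dots,i_r$ is written $(i_1|\cdots|i_r)$, $(i)$ is the length-zero path, and $(i_1|\cdots|i_r)(j_1|\cdots|j_s)=(i_1|\cdots|i_r|j_2|\cdots|j_s)$ if $i_r=j_1$ and $0$ otherwise. $A_n$ is the quotient of $\Bbbk Q_n$ by $(i|i\pm1|i\pm2)=0$, $(i|i+1|i)=(i|i-1|i)$ for $2\le i\le n-1$, and $(n|n-1|n)=0$, graded by $\deg(i)=\deg(i|i+1)=0$, $\deg(i+1|i)=1$. The zigzag algebra is $C_{n-1}=eA_ne$ with $e=(1)+\cdots+(n-1)$; its path basis is $(i)$, $(i|i+1|i)$ for $1\le i\le n-1$ and $(i|i+1)$, $(i+1|i)$ for $1\le i\le n-2$. **Hochschild complex.** $C^k(C_{n-1},C_{n-1})^{-1}$ denotes the space of linear maps $C_{n-1}^{\otimes k}\to C_{n-1}$ of degree $-1$. As usual for path algebras, cochains are taken relative to the semisimple subalgebra $\bigoplus_i\Bbbk(i)$: they vanish on non-composable tuples of paths and map a composable tuple of paths from $i$ to $j$ into $(i)C_{n-1}(j)$. The differential $\delta$ preserves the internal degree; for $m\in C^2$, $$(\delta m)(x,y,z)=x\,m(y,z)-m(xy,z)+m(x,yz)-m(x,y)z ,$$ and $\mathrm{HH}^\bullet(C_{n-1},C_{n-1})^{-1}$ is the cohomology of the complex $(C^\bullet(C_{n-1},C_{n-1})^{-1},\delta)$.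 The map $m_3$ is the ternary operation of the $A_\infty$-structure on $C_{n-1}$ (with $m_1=0$, $m_2$ the product, $m_k=0$ for $k>3$) obtained by homotopy transfer from a DG algebra with cohomology $C_{n-1}$; in particular $\delta m_3=0$. *)

(* Defs.v *)
From HB Require Import structures.
From mathcomp Require Import all_boot all_algebra.
From mathcomp Require Import boolp functions.
From mathcomp Require Import finmap.
From mathcomp Require Import monalg.

Set Implicit Arguments.
Unset Strict Implicit.
Unset Printing Implicit Defensive.

Import GRing.Theory.

Local Open Scope ring_scope.
Local Open Scope quotient_scope.

Lemma sum_nat_pick (V : nmodType) a b j (x : V) : (a <= j < b)%N ->
  \sum_(a <= i < b) (if i == j then x else 0) = x.
Proof. by move=> h; rewrite -big_mkcond big_nat1_eq h. Qed.

Lemma linear_id (k : nzRingType) (V : lmodType k) (I : Type) (b : I -> V)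
    (f : V -> V) :
  (forall P : V -> Prop,
     P 0 -> (forall a i x, P x -> P (a *: b i + x)) -> forall x, P x) ->
  {morph f : x y / x + y} -> (forall a x, a *: f x = f (a *: x)) ->
  (forall i, f (b i) = b i) -> forall x, f x = x.
Proof.
move=> ind fD fZ fb; elim/ind => [|a i x IH].
  by have := fZ 0 0; rewrite !scale0r.
by rewrite fD IH -fZ fb.
Qed.

Lemma bilinear_mulA (k : nzRingType) (V : lmodType k) (I : Type) (b : I -> V)
    (m : V -> V -> V) :
  (forall P : V -> Prop,
     P 0 -> (forall a i x, P x -> P (a *: b i + x)) -> forall x, P x) ->
  left_distributive m +%R -> right_distributive m +%R ->
  (forall a x y, a *: m x y = m (a *: x) y) ->
  (forall a x y, a *: m x y = m x (a *: y)) ->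
  (forall i j l, m (b i) (m (b j) (b l)) = m (m (b i) (b j)) (b l)) ->
  associative m.
Proof.
move=> ind Dl Dr Zl Zr mA.
have m0 x : m 0 x = 0 by have := Zl 0 0 x; rewrite !scale0r.
have m0r x : m x 0 = 0 by have := Zr 0 x 0; rewrite !scale0r.
move=> x y z.
elim/ind: x => [|a p x IHx]; first by rewrite !m0.
rewrite !Dl -IHx -!Zl; congr (_ *: _ + _).
move=> {IHx}; elim/ind: y => [|c q y IHy]; first by rewrite m0r !m0 m0r.
rewrite Dl !Dr Dl -IHy -!Zl -!Zr -!Zl; congr (_ *: _ + _).
move=> {IHy}; elim/ind: z => [|d r z IHz]; first by rewrite !m0r.
by rewrite !Dr -IHz -!Zr mA.
Qed.

Lemma monalgUZ (K : choiceType) (R : nzRingType) (c : R) (p : K) :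
  << c *g p >> = c *: << p >> :> {malg R[K]}.
Proof. by apply/malgP => q; rewrite mcoeffZ !mcoeffU mulr_natr. Qed.

(* A path (i_1|...|i_r) is encoded by its sequence of vertices, numbered from
   1 to n; the length-zero path (i) is [:: i]. *)
Definition is_path (n : nat) (s : seq nat) : bool :=
  [&& s != [::], all (fun i => 0 < i <= n)%N s &
      sorted (fun i j => (j == i.+1) || (i == j.+1)) s].

Definition qpath (n : nat) : Type := {s : seq nat | is_path n s}.
HB.instance Definition _ n := Choice.on (qpath n).
HB.instance Definition _ n := SubType.on (qpath n).

Definition src n (p : qpath n) : nat := head 0%N (val p).
Definition tgt n (p : qpath n) : nat := last 0%N (val p).

(* deg (i|i+1) = 0 and deg (i+1|i) = 1, so the degree of a path is the number
   of its arrows i+1 -> i. *)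
Definition desc (s : seq nat) : nat :=
  \sum_(0 <= j < (size s).-1) (nth 0 s j.+1 < nth 0 s j)%N.
Definition pdeg n (p : qpath n) : nat := desc (val p).

Definition pathalg (k : fieldType) (n : nat) : Type := {malg k[qpath n]}.
HB.instance Definition _ k n := Choice.on (pathalg k n).
HB.instance Definition _ k n := GRing.Lmodule.on (pathalg k n).

(* The path with vertex sequence s; 0 if s is not a path of Q_n.
   Here and below, definitions are locked only to keep unification from
   unfolding the underlying quotients and finitely supported functions. *)
HB.lock Definition ppath (k : fieldType) (n : nat) (s : seq nat) :
    pathalg k n :=
  if insub s is Some p then << p >> else 0.

Definition path_mul (k : fieldType) (n : nat) (p q : qpath n) : pathalg k n :=
  if tgt p == src q then ppath k n (val p ++ behead (val q)) else 0.

HB.lock Definition pathalg_mul (k : fieldType) (n : nat) (x y : pathalg k n) :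
    pathalg k n :=
  \sum_(p <- msupp x) \sum_(q <- msupp y) (x@_p * y@_q) *: path_mul k p q.

HB.lock Definition pathalg_one (k : fieldType) (n : nat) : pathalg k n :=
  \sum_(1 <= i < n.+1) ppath k n [:: i].

Section PathAlgebra.
Variables (k : fieldType) (n : nat).
Local Notation pathalg := (pathalg k n).
Local Notation ppath := (ppath k n).
Local Notation path_mul := (path_mul k).

Let lext (V : lmodType k) (f : qpath n -> V) (x : pathalg) : V :=
  \sum_(p <- msupp x) x@_p *: f p.

Let lextw (V : lmodType k) (f : qpath n -> V) (x : pathalg) D :
  (msupp x `<=` D)%fset -> lext f x = \sum_(p <- D) x@_p *: f p.
Proof.
move=> le_D; rewrite /lext; apply: big_fset_incl le_D _ => p _.
by move=> /mcoeff_outdom ->; rewrite scale0r.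
Qed.

Let lextU (V : lmodType k) (f : qpath n -> V) p : lext f << p >> = f p.
Proof. by rewrite (lextw _ msuppU_le) big_seq_fset1 mcoeffUU scale1r. Qed.

Let lextP (V : lmodType k) (f : qpath n -> V) a x y :
  lext f (a *: x + y) = a *: lext f x + lext f y.
Proof.
pose D := (msupp x `|` msupp y)%fset.
have hx : (msupp x `<=` D)%fset by apply: fsubsetUl.
have hy : (msupp y `<=` D)%fset by apply: fsubsetUr.
have hs : (msupp (a *: x + y) `<=` D)%fset.
  apply: fsubset_trans (msuppD_le _ _) _.
  by rewrite fsubUset hy andbT (fsubset_trans (msuppZ_le _ _)).
rewrite (lextw _ hx) (lextw _ hy) (lextw _ hs) scaler_sumr -big_split /=.
by apply: eq_bigr => p _; rewrite mcoeffD mcoeffZ scalerDl scalerA.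
Qed.

Let lextD (V : lmodType k) (f : qpath n -> V) x y :
  lext f (x + y) = lext f x + lext f y.
Proof. by have := lextP f 1 x y; rewrite !scale1r. Qed.

Let lext0 (V : lmodType k) (f : qpath n -> V) : lext f 0 = 0.
Proof. by rewrite /lext msupp0 big_seq_fset0. Qed.

Let lextZ (V : lmodType k) (f : qpath n -> V) a x :
  lext f (a *: x) = a *: lext f x.
Proof. by have := lextP f a x 0; rewrite (lext0 f) !addr0. Qed.

Let mulE x y : pathalg_mul x y = lext (fun p => lext (path_mul p) y) x.
Proof.
rewrite pathalg_mul.unlock; apply: eq_bigr => p _.
by rewrite /lext scaler_sumr; apply: eq_bigr => q _; rewrite scalerA.
Qed.

Lemma pathalgE (x : pathalg) : x = \sum_(p <- msupp x) x@_p *: (<< p >> : pathalg).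
Proof.
by rewrite {1}[x]monalgE; apply: eq_bigr => p _; apply: monalgUZ.
Qed.

Lemma pathalg_ind (P : pathalg -> Prop) :
  P 0 -> (forall a p x, P x -> P (a *: << p >> + x)) -> forall x, P x.
Proof. by move=> P0 PD x; rewrite [x]pathalgE; elim/big_rec: _ => *; auto. Qed.

Fact pathalg_mulDl : left_distributive (@pathalg_mul k n) +%R.
Proof. by move=> x y z; rewrite !mulE lextD. Qed.

Fact pathalg_mulDr : right_distributive (@pathalg_mul k n) +%R.
Proof.
move=> x y z; rewrite !mulE [LHS]/lext [X in _ = X + _]/lext [X in _ = _ + X]/lext.
by rewrite -big_split; apply: eq_bigr => p _ /=; rewrite -scalerDr -lextD.
Qed.

Fact pathalg_scalerAl (a : k) (x y : pathalg) :
  a *: pathalg_mul x y = pathalg_mul (a *: x) y.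
Proof. by rewrite !mulE lextZ. Qed.

Fact pathalg_scalerAr (a : k) (x y : pathalg) :
  a *: pathalg_mul x y = pathalg_mul x (a *: y).
Proof.
rewrite !mulE [X in _ *: X]/lext [RHS]/lext scaler_sumr; apply: eq_bigr => p _ /=.
by rewrite lextZ !scalerA mulrC.
Qed.

Let mulUU (p q : qpath n) : pathalg_mul << p >> << q >> = path_mul p q.
Proof. by rewrite mulE !lextU. Qed.

Let mul0 (x : pathalg) : pathalg_mul 0 x = 0. Proof. by rewrite mulE; apply: lext0. Qed.
Let mulr0 (x : pathalg) : pathalg_mul x 0 = 0.
Proof. by rewrite mulE /lext big1 // => p _; rewrite [X in _ *: X](lext0 (path_mul p)) scaler0. Qed.

Let ppathT s (h : is_path n s) : ppath s = << (Sub s h : qpath n) >>.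
Proof. by rewrite ppath.unlock insubT. Qed.

Let ppathU (p : qpath n) : ppath (val p) = << p >>.
Proof. by rewrite ppath.unlock valK. Qed.

Lemma is_path_cat s t : is_path n s -> is_path n t ->
  last 0%N s = head 0%N t -> is_path n (s ++ behead t).
Proof.
case: s => // a s; case: t => // b t /and3P[_ hs ps] /and3P[_ ht pt] e.
apply/and3P; split => //.
  rewrite all_cat hs /=; apply/allP => i it.
  by move/allP: ht => /(_ i); apply; rewrite inE it orbT.
rewrite /= cat_path; apply/andP; split; first exact: ps.
by move: e => /= ->; exact: pt.
Qed.

Let mul_ppath s t : is_path n s -> is_path n t ->
  pathalg_mul (ppath s) (ppath t) =
  if last 0%N s == head 0%N t then ppath (s ++ behead t) else 0.
Proof. by move=> hs ht; rewrite (ppathT hs) (ppathT ht) mulUU. Qed.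

Fact pathalg_mulA : associative (@pathalg_mul k n).
Proof.
apply: (bilinear_mulA pathalg_ind).
- exact: pathalg_mulDl.
- exact: pathalg_mulDr.
- exact: pathalg_scalerAl.
- exact: pathalg_scalerAr.
move=> p q r; rewrite -(ppathU p) -(ppathU q) -(ppathU r).
case: p q r => [s hs] [t ht] [u hu]; rewrite [val _]/= [val _]/= [val _]/=.
rewrite (mul_ppath hs ht) (mul_ppath ht hu).
have lastE : last 0%N s = head 0%N t -> last 0%N (s ++ behead t) = last 0%N t.
  by rewrite last_cat; case: (t) ht => // b t' _ /= ->.
have headE : head 0%N (t ++ behead u) = head 0%N t by case: (t) ht.
have [e1|e1] := eqVneq (last 0%N s) (head 0%N t);
  have [e2|e2] := eqVneq (last 0%N t) (head 0%N u).
- rewrite (mul_ppath hs (is_path_cat ht hu e2)) headE e1 eqxx.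
  rewrite (mul_ppath (is_path_cat hs ht e1) hu) lastE // e2 eqxx.
  by case: (t) ht => // b t' _; rewrite catA.
- by rewrite (mul_ppath (is_path_cat hs ht e1) hu) lastE // (negbTE e2) mulr0.
- rewrite (mul_ppath hs (is_path_cat ht hu e2)) headE (negbTE e1).
  by rewrite (mul0 (ppath u)).
- by rewrite (mul0 (ppath u)) (mulr0 (ppath s)).
Qed.

Lemma is_path1 i : (0 < i <= n)%N -> is_path n [:: i].
Proof. by move=> h; rewrite /is_path /= h. Qed.

Fact pathalg_mul1 : left_id (pathalg_one k n) (@pathalg_mul k n).
Proof.
apply: (linear_id pathalg_ind) => [x y|a x|p].
- exact: pathalg_mulDr.
- exact: pathalg_scalerAr.
rewrite -(ppathU p); case: p => s hs; rewrite [val _]/= pathalg_one.unlock.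
have hi : (0 < head 0 s <= n)%N by case: (s) hs => // b t /and3P[_ /andP[]].
have E i : (0 < i <= n)%N -> pathalg_mul (ppath [:: i]) (ppath s) =
   if i == head 0%N s then ppath s else 0.
  move=> h; rewrite mul_ppath ?is_path1 //=.
  by case: eqP => // ->; case: (s) hs.
rewrite (big_morph (fun x => pathalg_mul x (ppath s)) (fun x y => pathalg_mulDl x y (ppath s))
  (mul0 (ppath s))).
rewrite (eq_big_nat _ _ (F2 := fun i => if i == head 0%N s then ppath s else 0)).
  by apply: sum_nat_pick; rewrite ltnS.
by move=> i; rewrite ltnS; apply: E.
Qed.

Fact pathalg_mulr1 : right_id (pathalg_one k n) (@pathalg_mul k n).
Proof.
apply: (linear_id (f := fun x => pathalg_mul x (pathalg_one k n)) pathalg_ind) => [x y|a x|p].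
- exact: pathalg_mulDl.
- exact: pathalg_scalerAl.
rewrite -(ppathU p); case: p => s hs; rewrite [val _]/= pathalg_one.unlock.
have hi : (0 < last 0 s <= n)%N.
  by case: (s) hs => // b t /and3P[_ /allP h _]; apply/h/mem_last.
have E i : (0 < i <= n)%N -> pathalg_mul (ppath s) (ppath [:: i]) =
   if i == last 0%N s then ppath s else 0.
  by move=> h; rewrite mul_ppath ?is_path1 //= cats0 eq_sym.
rewrite (big_morph (fun x => pathalg_mul (ppath s) x) (pathalg_mulDr (ppath s)) (mulr0 (ppath s))).
rewrite (eq_big_nat _ _ (F2 := fun i => if i == last 0%N s then ppath s else 0)).
  by apply: sum_nat_pick; rewrite ltnS.
by move=> i; rewrite ltnS; apply: E.
Qed.

HB.instance Definition _ := GRing.Zmodule_isPzRing.Build pathalg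
  pathalg_mulA pathalg_mul1 pathalg_mulr1 pathalg_mulDl pathalg_mulDr.

Lemma ppathM s t : is_path n s -> is_path n t ->
  ppath s * ppath t =
  if last 0%N s == head 0%N t then ppath (s ++ behead t) else 0.
Proof. exact: mul_ppath. Qed.

Lemma pathalgZAl (a : k) (x y : pathalg) :
  a *: (x * y) = (a *: x : pathalg) * y.
Proof. exact: pathalg_scalerAl. Qed.

Lemma pathalgZAr (a : k) (x y : pathalg) :
  a *: (x * y) = x * (a *: y : pathalg).
Proof. exact: pathalg_scalerAr. Qed.

End PathAlgebra.

Section ZigzagIdeal.
Variables (k : fieldType) (n : nat).
Local Notation kQ := (pathalg k n).
Local Notation "'[p' s ]" := (ppath k n s) (at level 0, s at level 200).

Inductive zz_relation : kQ -> Prop :=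
| RelUp i of (0 < i)%N & (i.+2 <= n)%N :
    zz_relation [p [:: i; i.+1; i.+2]]
| RelDown i of (0 < i)%N & (i.+2 <= n)%N :
    zz_relation [p [:: i.+2; i.+1; i]]
| RelLoop i of (2 <= i)%N & (i <= n.-1)%N :
    zz_relation ([p [:: i; i.+1; i]] - [p [:: i; i.-1; i]])
| RelEnd of (2 <= n)%N :
    zz_relation [p [:: n; n.-1; n]].

(* Finite sums of a * s * b with s a relation, i.e. the two-sided ideal
   generated by the relations. *)
Inductive zz_span : kQ -> Prop :=
| ZzSpan0 : zz_span 0
| ZzSpanD a s b x : zz_relation s -> zz_span x -> zz_span (a * s * b + x).

Definition zz_ideal : pred kQ := fun x => `[< zz_span x >].

Lemma zz_spanD x y : zz_span x -> zz_span y -> zz_span (x + y).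
Proof.
elim=> [|a s b z Ss _ IH] Hy; first by rewrite add0r.
by rewrite -addrA; apply: ZzSpanD => //; apply: IH.
Qed.

Lemma zz_spanM c x d : zz_span x -> zz_span (c * x * d).
Proof.
elim=> [|a s b z Ss _ IH]; first by rewrite mulr0 mul0r; constructor.
rewrite mulrDr mulrDl !mulrA -[_ * b * d]mulrA.
exact: ZzSpanD.
Qed.

Lemma zz_idealM c x d : x \in zz_ideal -> c * x * d \in zz_ideal.
Proof. by move=> /asboolP h; apply/asboolP/zz_spanM. Qed.

Fact zz_ideal_closed : zmod_closed zz_ideal.
Proof.
split; first by apply/asboolP; constructor.
move=> x y /asboolP hx hy; apply/asboolP/zz_spanD => //; apply/asboolP.
by have := zz_idealM (-1) 1 hy; rewrite mulr1 mulN1r.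
Qed.

HB.instance Definition _ := GRing.isZmodClosed.Build kQ zz_ideal
  zz_ideal_closed.

Lemma zz_idealMl c x : x \in zz_ideal -> c * x \in zz_ideal.
Proof. by move=> /(zz_idealM c 1); rewrite mulr1. Qed.

Lemma zz_idealMr c x : x \in zz_ideal -> x * c \in zz_ideal.
Proof. by move=> /(zz_idealM 1 c); rewrite mul1r. Qed.

Lemma zz_idealZ (a : k) x : x \in zz_ideal -> a *: x \in zz_ideal.
Proof.
move=> h; have -> : a *: x = (a *: (1 : kQ) : kQ) * x.
  by rewrite -pathalgZAl mul1r.
exact: zz_idealMl.
Qed.

End ZigzagIdeal.

(* A_n, the quotient of the path algebra of Q_n by zz_ideal. *)
Definition zzA (k : fieldType) (n : nat) : Type :=
  Quotient.quot (GRing.ZmodClosed.clone (pathalg k n) (@zz_ideal k n) _).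

HB.instance Definition _ k n := Choice.on (zzA k n).
HB.instance Definition _ k n := EqQuotient.on (zzA k n).
HB.instance Definition _ k n := GRing.Zmodule.on (zzA k n).
HB.instance Definition _ k n := ZmodQuotient.on (zzA k n).

HB.lock Definition zz_pi (k : fieldType) (n : nat) (x : pathalg k n) :
  zzA k n := \pi x.

HB.lock Definition zzA_scale (k : fieldType) (n : nat) (a : k) (x : zzA k n) :
  zzA k n := zz_pi (a *: repr x).

HB.lock Definition zzA_mul (k : fieldType) (n : nat) (x y : zzA k n) :
  zzA k n := zz_pi (repr x * repr y).

Section ZigzagAlgebra.
Variables (k : fieldType) (n : nat).
Local Notation kQ := (pathalg k n).
Local Notation zz_ideal := (@zz_ideal k n).
Local Notation zzA := (zzA k n).
Local Notation "'[p' s ]" := (ppath k n s) (at level 0, s at level 200).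

Lemma zz_piE (x y : kQ) : (zz_pi x == zz_pi y) = (x - y \in zz_ideal).
Proof.
by rewrite zz_pi.unlock (Quotient.idealrBE (GRing.ZmodClosed.clone kQ zz_ideal _)).
Qed.

Lemma zz_piD (x y : kQ) : zz_pi (x + y) = zz_pi x + zz_pi y.
Proof. by rewrite zz_pi.unlock; exact: (raddfD (\pi_zzA)). Qed.

Lemma zz_repr (x : zzA) : zz_pi (repr x) = x.
Proof. by rewrite zz_pi.unlock; exact: reprK. Qed.

Fact zz_piZ a (x : kQ) : zzA_scale a (zz_pi x) = zz_pi (a *: x).
Proof.
by rewrite zzA_scale.unlock; apply/eqP; rewrite zz_piE -scalerBr zz_idealZ // -zz_piE zz_repr.
Qed.

Fact zz_piM (x y : kQ) : zzA_mul (zz_pi x) (zz_pi y) = zz_pi (x * y).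
Proof.
rewrite zzA_mul.unlock; apply/eqP; rewrite zz_piE.
set x' := repr _; set y' := repr _.
have hx : x' - x \in zz_ideal by rewrite -zz_piE zz_repr.
have hy : y' - y \in zz_ideal by rewrite -zz_piE zz_repr.
have -> : x' * y' - x * y = (x' - x) * y' + x * (y' - y).
  by rewrite mulrBl mulrBr addrA subrK.
by apply: rpredD; [apply: zz_idealMr | apply: zz_idealMl].
Qed.

Fact zzA_scalerA a b (x : zzA) : zzA_scale a (zzA_scale b x) = zzA_scale (a * b) x.
Proof. by rewrite -[x]zz_repr !zz_piZ scalerA. Qed.

Fact zzA_scale1r : left_id 1 (@zzA_scale k n).
Proof. by move=> x; rewrite -[x]zz_repr zz_piZ scale1r. Qed.

Fact zzA_scalerDr : right_distributive (@zzA_scale k n) +%R.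
Proof.
move=> a x y; rewrite -[x]zz_repr -[y]zz_repr -zz_piD !zz_piZ -zz_piD.
by rewrite scalerDr.
Qed.

Fact zzA_scalerDl (x : zzA) : {morph (fun a => zzA_scale a x) : a b / a + b}.
Proof. by move=> a b; rewrite -[x]zz_repr !zz_piZ -zz_piD scalerDl. Qed.

HB.instance Definition _ := GRing.Zmodule_isLmodule.Build k zzA
  zzA_scalerA zzA_scale1r zzA_scalerDr zzA_scalerDl.

Fact zzA_mulA : associative (@zzA_mul k n).
Proof.
by move=> x y z; rewrite -[x]zz_repr -[y]zz_repr -[z]zz_repr !zz_piM mulrA.
Qed.

Fact zzA_mul1 : left_id (zz_pi 1) (@zzA_mul k n).
Proof. by move=> x; rewrite -[x]zz_repr zz_piM mul1r. Qed.

Fact zzA_mulr1 : right_id (zz_pi 1) (@zzA_mul k n).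
Proof. by move=> x; rewrite -[x]zz_repr zz_piM mulr1. Qed.

Fact zzA_mulDl : left_distributive (@zzA_mul k n) +%R.
Proof.
move=> x y z; rewrite -[x]zz_repr -[y]zz_repr -[z]zz_repr -zz_piD !zz_piM -zz_piD.
by rewrite mulrDl.
Qed.

Fact zzA_mulDr : right_distributive (@zzA_mul k n) +%R.
Proof.
move=> x y z; rewrite -[x]zz_repr -[y]zz_repr -[z]zz_repr -zz_piD !zz_piM -zz_piD.
by rewrite mulrDr.
Qed.

HB.instance Definition _ := GRing.Zmodule_isPzRing.Build zzA
  zzA_mulA zzA_mul1 zzA_mulr1 zzA_mulDl zzA_mulDr.

Lemma zz_pi_mul (x y : kQ) : zz_pi (x * y) = zz_pi x * zz_pi y.
Proof. by symmetry; apply: zz_piM. Qed.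

Lemma zz_pi_scale a (x : kQ) : zz_pi (a *: x) = a *: zz_pi x.
Proof. by symmetry; apply: zz_piZ. Qed.

Lemma zzA_scalerAl a (x y : zzA) : a *: (x * y) = (a *: x) * y.
Proof.
rewrite -[x]zz_repr -[y]zz_repr -!(zz_pi_mul, zz_pi_scale).
by rewrite pathalgZAl.
Qed.

Lemma zzA_scalerAr a (x y : zzA) : a *: (x * y) = x * (a *: y).
Proof.
rewrite -[x]zz_repr -[y]zz_repr -!(zz_pi_mul, zz_pi_scale).
by rewrite pathalgZAr.
Qed.

Definition zz_e : zzA := zz_pi (\sum_(1 <= i < n) [p [:: i]]).

Lemma zz_ee : zz_e * zz_e = zz_e.
Proof.
rewrite -zz_pi_mul mulr_suml; congr zz_pi; apply: eq_big_nat => i /andP[i0 ilt].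
have Hi j : (0 < j < n)%N -> is_path n [:: j].
  by move=> /andP[j0 jn]; apply: is_path1; rewrite j0 ltnW.
rewrite mulr_sumr.
rewrite (eq_big_nat _ _ (F2 := fun j => if j == i then [p [:: i]] else 0)).
  by apply: sum_nat_pick; rewrite i0.
by move=> j hj; rewrite ppathM ?Hi ?i0 //= eq_sym.
Qed.

Definition zz_corner : pred zzA := fun x => `[< exists a, x = zz_e * a * zz_e >].

Fact zz_corner_closed : GRing.subsemimod_closed zz_corner.
Proof.
split; first split.
- by apply/asboolP; exists 0; rewrite mulr0 mul0r.
- move=> x y /asboolP[a ->] /asboolP[b ->]; apply/asboolP.
  by exists (a + b); rewrite mulrDr mulrDl.
- move=> c x /asboolP[a ->]; apply/asboolP.
  by exists (c *: a); rewrite -zzA_scalerAr -zzA_scalerAl.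
Qed.

Fact zz_cornerM x y :
  x \in zz_corner -> y \in zz_corner -> x * y \in zz_corner.
Proof.
move=> /asboolP[a ->] /asboolP[b ->]; apply/asboolP.
by exists (a * zz_e * zz_e * b); rewrite !mulrA.
Qed.

Fact zz_cornerP a : zz_e * a * zz_e \in zz_corner.
Proof. by apply/asboolP; exists a. Qed.

Fact zz_corner1 : zz_e \in zz_corner.
Proof. by apply/asboolP; exists zz_e; rewrite !zz_ee. Qed.

(* [zigzag k n] is C_{n-1} = e A_n e (index shifted by one), with unit e. *)
Record zigzag : Type := Zigzag { zz_val : zzA; zz_valP : zz_val \in zz_corner }.

HB.instance Definition _ := [isSub for zz_val].
HB.instance Definition _ := [Choice of zigzag by <:].
HB.instance Definition _ := GRing.SubChoice_isSubLmodule.Build k zzA zz_corner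
  zigzag zz_corner_closed.

Definition zigzag_mul (x y : zigzag) : zigzag :=
  Zigzag (zz_cornerM (zz_valP x) (zz_valP y)).
Definition zigzag_one : zigzag := Zigzag zz_corner1.

Fact zigzag_mulA : associative zigzag_mul.
Proof. by move=> x y z; apply: val_inj; rewrite /= mulrA. Qed.

Fact zigzag_mul1 : left_id zigzag_one zigzag_mul.
Proof.
move=> x; apply: val_inj => /=; have /asboolP[a ->] := zz_valP x.
by rewrite !mulrA zz_ee.
Qed.

Fact zigzag_mulr1 : right_id zigzag_one zigzag_mul.
Proof.
move=> x; apply: val_inj => /=; have /asboolP[a ->] := zz_valP x.
by rewrite -!mulrA zz_ee.
Qed.

Fact zigzag_mulDl : left_distributive zigzag_mul +%R.
Proof. by move=> x y z; apply: val_inj; rewrite /= mulrDl. Qed.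

Fact zigzag_mulDr : right_distributive zigzag_mul +%R.
Proof. by move=> x y z; apply: val_inj; rewrite /= mulrDr. Qed.

HB.instance Definition _ := GRing.Zmodule_isPzRing.Build zigzag
  zigzag_mulA zigzag_mul1 zigzag_mulr1 zigzag_mulDl zigzag_mulDr.

Lemma zigzag_scalerAl a (x y : zigzag) : a *: (x * y) = (a *: x) * y.
Proof. by apply: val_inj; rewrite /= zzA_scalerAl. Qed.

Lemma zigzag_scalerAr a (x y : zigzag) : a *: (x * y) = x * (a *: y).
Proof. by apply: val_inj; rewrite /= zzA_scalerAr. Qed.

(* The class of a path of Q_n cut down to C_{n-1}: it is the class of the path
   if both ends lie in {1, ..., n-1}, and 0 otherwise. *)
Definition zpath (s : seq nat) : zigzag := Zigzag (zz_cornerP (zz_pi [p s])).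

(* Homogeneous elements of C_{n-1}; indexing by int makes the components of
   negative degree zero. *)
Definition zdeg (d : int) (x : zigzag) : Prop :=
  exists2 g : kQ, (forall p, p \in msupp g -> (pdeg p)%:Z = d) &
                  zz_val x = zz_pi g.

Definition path_basis : seq (seq nat) :=
  [seq [:: i] | i <- iota 1 n.-1] ++
  [seq [:: i; i.+1; i] | i <- iota 1 n.-1] ++
  [seq [:: i; i.+1] | i <- iota 1 n.-2] ++
  [seq [:: i.+1; i] | i <- iota 1 n.-2].

End ZigzagAlgebra.

Section HochschildComplex.
Variables (k : fieldType) (n : nat).
Local Notation C := (zigzag k n).
Local Notation kpath := (zpath k n).

Definition tset r (t : r.-tuple C) (i : 'I_r) (x : C) : r.-tuple C :=
  [tuple if j == i then x else tnth t j | j < r].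

Definition multilinear r (f : r.-tuple C -> C) : Prop :=
  forall (t : r.-tuple C) (i : 'I_r) (a : k) (x y : C),
    f (tset t i (a *: x + y)) = a *: f (tset t i x) + f (tset t i y).

Definition composable (ps : seq (qpath n)) : bool :=
  sorted (fun p q => tgt p == src q) ps.

(* Cochains relative to the span of the (i). The paths ps range over all paths
   of Q_n; those starting or ending at n have class 0 in C_{n-1}.
   For r = 0 there is no tuple of paths to compose: a 0-cochain is an element
   of the sum of the (i)C(i), i.e. it commutes with every (i). *)
Definition relative r : (r.-tuple C -> C) -> Prop :=
  match r with
  | 0 => fun f =>
      forall i, kpath [:: i] * f [tuple] = f [tuple] * kpath [:: i]
  | r'.+1 => fun f =>
      forall ps : r'.+1.-tuple (qpath n),
        let x := [tuple kpath (val (tnth ps j)) | j < r'.+1] in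
        if composable ps then
          exists c, f x = kpath [:: src (tnth ps ord0)] * c *
                          kpath [:: tgt (tnth ps ord_max)]
        else f x = 0
  end.

(* f lies in C^r(C_{n-1}, C_{n-1})^d; multilinear maps on r-tuples stand for
   linear maps on the r-fold tensor power. *)
Definition is_cochain r (d : int) (f : r.-tuple C -> C) : Prop :=
  [/\ multilinear f, relative f
    & forall (t : r.-tuple C) (e : 'I_r -> int),
        (forall i, zdeg (e i) (tnth t i)) -> zdeg (\sum_i e i + d) (f t)].

(* (x_0, ..., x_r) |-> (x_0, ..., x_i x_{i+1}, ..., x_r) *)
Definition contract r (i : 'I_r) (t : r.+1.-tuple C) : r.-tuple C :=
  [tuple if (j < i)%N then tnth t (widen_ord (leqnSn r) j)
         else if j == i then
           tnth t (widen_ord (leqnSn r) j) * tnth t (lift ord0 j)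
         else tnth t (lift ord0 j) | j < r].

Definition hochd r (f : r.-tuple C -> C) (t : r.+1.-tuple C) : C :=
  tnth t ord0 * f [tuple tnth t (lift ord0 j) | j < r]
  + \sum_(i < r) (-1) ^+ i.+1 * f (contract i t)
  + (-1) ^+ r.+1 *
    (f [tuple tnth t (widen_ord (leqnSn r) j) | j < r] * tnth t ord_max).

Lemma hochd2E (m : 2.-tuple C -> C) (x y z : C) :
  hochd m [tuple x; y; z] =
  x * m [tuple y; z] - m [tuple x * y; z] + m [tuple x; y * z]
  - m [tuple x; y] * z.
Proof.
rewrite /hochd !big_ord_recl big_ord0 /= addr0 !exprS expr0 !mulr1 mulrN1 opprK.
rewrite !mulN1r mul1r !addrA.
by do 4?congr (_ + _); rewrite ?mulN1r; do ?congr (- _); do ?congr (_ * _);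
  congr m; apply: eq_from_tnth => -[[|[|//]] ?]; rewrite !tnth_mktuple.
Qed.

Lemma zdeg0 d : zdeg d (0 : C).
Proof.
exists 0 => [p|]; first by rewrite msupp0 in_fset0.
by have := zz_piD (0 : pathalg k n) 0; rewrite addr0 => /eqP;
  rewrite -subr_eq0 opprD addrA subrr add0r oppr_eq0 => /eqP ->.
Qed.

Lemma zdegB d (x y : C) : zdeg d x -> zdeg d y -> zdeg d (x - y).
Proof.
move=> [g hg ex] [h hh ey]; exists (g - h) => [p|].
  by move/(fsubsetP (msuppB_le _ _)); rewrite in_fsetU => /orP[/hg|/hh].
rewrite [LHS]/= ex ey; apply/eqP; rewrite subr_eq -zz_piD.
by rewrite subrK.
Qed.

Lemma is_cochain0 r d : is_cochain d (0 : r.-tuple C -> C).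
Proof.
split.
- by move=> t i a x y; rewrite scaler0 addr0.
- case: r => [i|r ps]; first by rewrite mulr0 mul0r.
  cbv zeta; case: (composable ps) => //.
  by exists 0; rewrite mulr0 mul0r.
- by move=> t e _; exact: zdeg0.
Qed.

Lemma is_cochainB r d (f g : r.-tuple C -> C) :
  is_cochain d f -> is_cochain d g -> is_cochain d (f - g).
Proof.
move=> [lf rf df] [lg rg dg]; split.
- move=> t i a x y; have E s : (f - g) s = f s - g s by [].
  by rewrite !E lf lg scalerBr opprD addrACA.
- case: r f g lf rf df lg rg dg => [|r] f g lf rf df lg rg dg.
    move=> i; have E s : (f - g) s = f s - g s by [].
    by rewrite !E mulrBr mulrBl rf rg.
  move=> ps; cbv zeta; have E s : (f - g) s = f s - g s by [].
  have := rf ps; have := rg ps; cbv zeta; case: (composable ps).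
    by move=> [c Ec] [b Eb]; exists (b - c); rewrite E Ec Eb mulrBr mulrBl.
  by move=> Ec Eb; rewrite E Ec Eb subrr.
- by move=> t e he; apply: zdegB; [apply: df | apply: dg].
Qed.

Lemma hochdB r (f g : r.-tuple C -> C) : hochd (f - g) = hochd f - hochd g.
Proof.
have E s : (f - g) s = f s - g s by [].
apply/funext => t; rewrite [RHS]/= /hochd.
have -> : \sum_(i < r) (-1) ^+ i.+1 * (f - g) (contract i t) =
   \sum_(i < r) (-1) ^+ i.+1 * f (contract i t)
   - \sum_(i < r) (-1) ^+ i.+1 * g (contract i t).
  by rewrite -sumrB; apply: eq_bigr => i _; rewrite E mulrBr.
have add3B (a a' b b' c c' : C) :
    (a - a') + (b - b') + (c - c') = (a + b + c) - (a' + b' + c').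
  by rewrite (addrACA a) (addrACA (a + b)) !opprD.
by rewrite !E !mulrBr !mulrBl !mulrBr add3B.
Qed.

Definition cocycles r d : pred (r.-tuple C -> C) :=
  fun f => `[< is_cochain d f /\ hochd f = 0 >].

Fact cocycles_closed r d : zmod_closed (@cocycles r d).
Proof.
have h00 : hochd (0 : r.-tuple C -> C) = 0.
  by have := hochdB (0 : r.-tuple C -> C) 0; rewrite !subrr.
split; first by apply/asboolP; split; [apply: is_cochain0 |].
move=> f g /asboolP[cf hf] /asboolP[cg hg]; apply/asboolP.
by split; [apply: is_cochainB | rewrite hochdB hf hg subrr].
Qed.

Record cocycle r (d : int) : Type := Cocycle {
  cocycle_val :> r.-tuple C -> C;
  cocycle_valP : cocycle_val \in cocycles d
}.

HB.instance Definition _ r d := [isSub for @cocycle_val r d].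
HB.instance Definition _ r d := [Choice of cocycle r d by <:].
HB.instance Definition _ r d := GRing.SubChoice_isSubZmodule.Build
  (r.-tuple C -> C) (@cocycles r d) (cocycle r d) (@cocycles_closed r d).

Definition is_coboundary (d : int) r : (r.-tuple C -> C) -> Prop :=
  match r with
  | 0 => fun f => f = 0
  | r'.+1 => fun f => exists2 m : r'.-tuple C -> C, is_cochain d m & hochd m = f
  end.

Definition coboundaries r d : pred (cocycle r d) :=
  fun z => `[< is_coboundary d (cocycle_val z) >].

Fact coboundaries_closed r d : zmod_closed (@coboundaries r d).
Proof.
split.
  apply/asboolP; case: r => [//|r]; exists 0; first exact: is_cochain0.
  by have := hochdB (0 : r.-tuple C -> C) 0; rewrite !subrr.
case: r => [|r] x y /asboolP /= hx /asboolP /= hy; apply/asboolP.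
  by rewrite /= hx hy subrr.
case: hx hy => f cf ef [g cg eg]; exists (f - g); first exact: is_cochainB.
by rewrite hochdB ef eg.
Qed.

HB.instance Definition _ r d := GRing.isZmodClosed.Build (cocycle r d)
  (@coboundaries r d) (@coboundaries_closed r d).

(* HH^r(C_{n-1}, C_{n-1})^d, cocycles modulo coboundaries. *)
Definition HH r d : Type :=
  Quotient.quot (GRing.ZmodClosed.clone (cocycle r d) (@coboundaries r d) _).

HB.instance Definition _ r d := Choice.on (HH r d).
HB.instance Definition _ r d := EqQuotient.on (HH r d).
HB.instance Definition _ r d := GRing.Zmodule.on (HH r d).

Definition hh_class r d (z : cocycle r d) : HH r d := \pi z.

Lemma hh_class_eq0 r d (z : cocycle r d) :
  hh_class z = 0 <-> is_coboundary d (cocycle_val z).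
Proof.
pose I := GRing.ZmodClosed.clone (cocycle r d) (@coboundaries r d) _.
have E : (z \in I) = (hh_class z == 0 :> HH r d).
  have := Quotient.idealrBE I z 0; rewrite subr0 => ->.
  by congr (_ == _); exact: (raddf0 (\pi_(Quotient.quot I))).
split=> [h|h]; first by apply/asboolP; move: (E); rewrite h eqxx.
by apply/eqP; rewrite -E; apply/asboolP.
Qed.

(* m3_rule s t u v: the map m_3 sends (s, t, u) to v. *)
Inductive m3_rule : seq nat -> seq nat -> seq nat -> seq nat -> Prop :=
| M3Rule1 i of (1 <= i)%N & (i <= n.-2)%N :
    m3_rule [:: i; i.+1] [:: i.+1; i] [:: i; i.+1; i] [:: i; i.+1; i]
| M3Rule2 i of (2 <= i)%N & (i <= n.-1)%N :
    m3_rule [:: i.-1; i] [:: i; i.-1] [:: i.-1; i] [:: i.-1; i]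
| M3Rule3 i of (2 <= i)%N & (i <= n.-1)%N :
    m3_rule [:: i; i.+1; i] [:: i; i.-1] [:: i.-1; i] [:: i; i.+1; i].

Definition is_m3 (m : 3.-tuple C -> C) : Prop :=
  [/\ multilinear m,
      forall s t u v, m3_rule s t u v ->
        m [tuple kpath s; kpath t; kpath u] = kpath v
    & forall s t u, s \in path_basis n -> t \in path_basis n ->
        u \in path_basis n -> (forall v, ~ m3_rule s t u v) ->
        m [tuple kpath s; kpath t; kpath u] = 0].

End HochschildComplex.

(* Main.v *)
Require Import Defs.
From HB Require Import structures.
From mathcomp Require Import all_boot all_algebra.
From mathcomp Require Import boolp functions finmap monalg zify ring.

Set Implicit Arguments.
Unset Strict Implicit.
Unset Printing Implicit Defensive.

Import GRing.Theory.
Local Open Scope ring_scope.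

(** The classes of the paths in the path basis are linearly independent because
    each coordinate is the sum of the coefficients of at most two paths of Q_n,
    a functional that vanishes on the ideal of relations. Hence m_3 exists and
    is unique, and by multilinearity it is a cocycle as soon as delta m_3
    vanishes on basis quadruples, where its nonzero terms are equal in pairs and
    cancel in characteristic 2.

    Suppose delta m = m_3. Put u = (1|2), d = (2|1), l = (1|2|1), l' = (2|3|2),
    and let lambda, lambda' be the coefficients of l in m(l,l) and of l' in
    m(l',l'). In characteristic 2, eliminating the other values of m from the
    equations for (u,d,u), (l,u,d), (d,u,l') gives lambda + lambda' = 1, while
    (d,u,d), (u,d,l), (l',d,u) give lambda + lambda' = 0. *)

(** * The path basis of C_{n-1} as a datatype *)

Inductive zz_basis : Type :=
  Vtx of nat | Up of nat | Down of nat | Loop of nat.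

(** [Up i] and [Down i] are the two arrows of the edge between i and i+1, both indexed by its lower
    end. Injectivity of this encoding supplies the decidable equality on the basis. *)
Definition word (b : zz_basis) : seq nat :=
  match b with
  | Vtx i => [:: i]
  | Up i => [:: i; i.+1]
  | Down i => [:: i.+1; i]
  | Loop i => [:: i; i.+1; i]
  end.

Lemma word_inj : injective word.
Proof. by case=> i [] j //= []; do ?[move=> ->]; move=> *; try congr (_ _); lia. Qed.

HB.instance Definition _ := Equality.copy zz_basis (inj_type word_inj).

Definition bsrc (b : zz_basis) : nat := head 0%N (word b).
Definition btgt (b : zz_basis) : nat := last 0%N (word b).

(** Only the ends of a path must lie below n: [Loop i] with i = n-1 passes through n and is kept,
    whereas an arrow needs i+1 < n. *)
Definition in_corner (n : nat) (b : zz_basis) : bool :=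
  match b with
  | Vtx i | Loop i => 0 < i < n
  | Up i | Down i => 0 < i < n.-1
  end%N.

Definition corner_basis (n : nat) : seq zz_basis :=
  [seq Vtx i | i <- iota 1 n.-1] ++ [seq Loop i | i <- iota 1 n.-1] ++
  [seq Up i | i <- iota 1 n.-2] ++ [seq Down i | i <- iota 1 n.-2].

Lemma path_basisE n : path_basis n = map word (corner_basis n).
Proof. by rewrite /corner_basis !map_cat -!map_comp. Qed.

Lemma mem_corner_basis n b : (b \in corner_basis n) = in_corner n b.
Proof.
have inj (f : nat -> zz_basis) i s : injective f -> (f i \in map f s) = (i \in s).
  by move=> hf; rewrite mem_map.
have ninj (f : nat -> zz_basis) s : (forall i, b <> f i) -> (b \in map f s) = false.
  by move=> hf; apply/negP => /mapP[i _ /hf].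
rewrite /corner_basis !mem_cat; case: b ninj => i ninj.
- rewrite inj; last by move=> ? ? [].
  by rewrite !ninj // !orbF mem_iota /=; lia.
- rewrite [in RHS]/in_corner (ninj Vtx) // (ninj Loop) // (ninj Down) // inj; last by move=> ? ? [].
  by rewrite /= orbF mem_iota /=; lia.
- rewrite [in RHS]/in_corner (ninj Vtx) // (ninj Loop) // (ninj Up) // inj; last by move=> ? ? [].
  by rewrite /= mem_iota /=; lia.
- rewrite [in RHS]/in_corner (ninj Vtx) // (ninj Up) // (ninj Down) // inj; last by move=> ? ? [].
  by rewrite /= !orbF mem_iota /=; lia.
Qed.

Lemma corner_basis_uniq n : uniq (corner_basis n).
Proof.
have dis (f g : nat -> zz_basis) s t : (forall i j, g i <> f j) ->
    has (mem (map f s)) (map g t) = false.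
  move=> fg; apply/hasP => -[_ /mapP[i _ ->] /mapP[j _ /fg]] //.
rewrite /corner_basis !cat_uniq !has_cat !dis // !orbF /=.
by rewrite !map_inj_uniq ?iota_uniq //= => ? ? [].
Qed.

(* The basis element represented by a path of Q_n in C_{n-1}; None if its class
   is zero, which includes the paths with an end at n. *)
Definition nf (n : nat) (s : seq nat) : option zz_basis :=
  if (head 0 s < n)%N && (last 0 s < n)%N then
    match s with
    | [:: i] => Some (Vtx i)
    | [:: i; j] => Some (if j == i.+1 then Up i else Down j)
    | [:: i; j; l] => if i == l then Some (Loop i) else None
    | _ => None
    end
  else None.

(** * Coordinate functionals on the path algebra *)

Section PathAlgebraCoordinates.
Variables (k : fieldType) (n : nat).
Local Notation kQ := (pathalg k n).
Local Notation pp := (ppath k n).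

(** Indexing by words gives the default 0 to a word that is not a path of Q_n, such as
    [[:: 1; 0; 1]] in the coordinate of [Loop 1]. *)
Definition path_coef (s : seq nat) (g : kQ) : k :=
  if insub s is Some p then g@_p else 0.

(* The loop (i|i+1|i) of A_n is also represented by (i|i-1|i). *)
Definition qcoord (b : zz_basis) (g : kQ) : k :=
  path_coef (word b) g +
  if b is Loop i then path_coef [:: i; i.-1; i] g else 0.

Lemma path_coefP s a x y : path_coef s (a *: x + y) = a * path_coef s x + path_coef s y.
Proof.
rewrite /path_coef; case: insub => [p|]; last by rewrite mulr0 addr0.
by rewrite mcoeffD mcoeffZ.
Qed.

Lemma qcoordP b a x y : qcoord b (a *: x + y) = a * qcoord b x + qcoord b y.
Proof.
rewrite /qcoord; case: b => i; rewrite !path_coefP ?addr0 //.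
by rewrite mulrDr addrACA.
Qed.

Lemma qcoord0 b : qcoord b 0 = 0.
Proof. by have := qcoordP b (-1) 0 0; rewrite scaler0 addr0 mulN1r addNr. Qed.

Lemma qcoordB b x y : qcoord b (x - y) = qcoord b x - qcoord b y.
Proof. by have := qcoordP b (-1) y x; rewrite scaleN1r mulN1r addrC [RHS]addrC. Qed.

Lemma path_coef_ppath s t : is_path n t -> path_coef s (pp t) = (s == t)%:R.
Proof.
move=> ht; rewrite ppath.unlock insubT /path_coef.
case: insubP => [p hs ep|/negbTE hs].
  by rewrite mcoeffU -ep [val _ == _]eq_sym.
by case: eqP => // est; rewrite est ht in hs.
Qed.

Definition represents (b : zz_basis) (t : seq nat) : bool :=
  (t == word b) || (if b is Loop i then t == [:: i; i.-1; i] else false).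

Lemma qcoord_ppath b t : is_path n t ->
  qcoord b (pp t) = (represents b t)%:R.
Proof.
move=> ht; rewrite /qcoord /represents; case: b => i;
  rewrite !path_coef_ppath //= ?addr0 ?orbF eq_sym //.
rewrite ![_ == t]eq_sym; case: eqP => [->|_]; last by rewrite add0r.
by case: eqP => [[]|]; rewrite ?addr0 //; lia.
Qed.

Lemma qcoord_long b t : is_path n t -> (3 < size t)%N -> qcoord b (pp t) = 0.
Proof.
move=> ht st; rewrite qcoord_ppath // /represents.
by case: b => i; do ?[case: eqP => [e|_]; first by rewrite e in st].
Qed.

Lemma ppathMM (p q s : seq nat) : is_path n p -> is_path n q -> is_path n s ->
  size s = 3%N ->
  pp p * pp s * pp q = if (last 0%N p == head 0%N s) && (last 0%N s == head 0%N q)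
  then pp (p ++ behead s ++ behead q) else 0.
Proof.
move=> hp hq hs es; rewrite ppathM //; case: eqP => [e1|] /=; last by rewrite mul0r.
rewrite ppathM ?(is_path_cat hp hs) //.
have -> : last 0%N (p ++ behead s) = last 0%N s.
  by rewrite last_cat; case: s es {hs e1} => [|a [|b s]].
by rewrite catA.
Qed.

(** Multiplying a three-vertex path by a path of positive length gives zero or a path with more than
    three vertices, which no coordinate sees. Only length-zero factors at the matching ends
    contribute. *)
Lemma qcoord_ppathMM b (p q s : seq nat) : is_path n p -> is_path n q -> is_path n s ->
  size s = 3%N ->
  qcoord b (pp p * pp s * pp q) =
  if [&& p == [:: head 0%N s] & q == [:: last 0%N s]] then qcoord b (pp s) else 0.
Proof.
move=> hp hq hs es; rewrite ppathMM //.
case: p hp => [//|a p] hp; case: q hq => [//|c q] hq.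
case: s hs es => [|s0 [|s1 [|s2 [|]]]] // hs _.
have [e1|ne1] := boolP (last a p == s0); last first.
  rewrite qcoord0 /=; case: eqP => // -[e ep]; subst.
  by rewrite eqxx in ne1.
have [e2|ne2] := boolP (s2 == c); last first.
  rewrite /= qcoord0; case: eqP => //= _.
  by case: eqP => //= -[e _]; rewrite e eqxx in ne2.
have hw : is_path n ((a :: p) ++ [:: s1; s2] ++ q).
  have h1 := is_path_cat hp hs (eqP e1).
  have h2 := is_path_cat h1 hq; rewrite -catA in h2; apply: h2.
  by rewrite last_cat /= (eqP e2).
case: p hp e1 hw => [|p0 p] hp e1 hw; last first.
  rewrite /= qcoord_long //; last by rewrite /= size_cat /=; lia.
  by rewrite !eqseq_cons andbF.
case: q hq e2 hw => [|q0 q] hq e2 hw; last first.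
  rewrite /= qcoord_long //.
  by rewrite !eqseq_cons !andbF.
by rewrite /= in e1; rewrite /= -(eqP e2) (eqP e1) !eqxx.
Qed.

Lemma in_corner_path b : in_corner n b -> is_path n (word b).
Proof. by case: b => i /= h; rewrite /is_path /= ?eqxx ?orbT; lia. Qed.

Lemma is_path3 i j : (0 < i <= n)%N -> (0 < j <= n)%N ->
  (j == i.+1) || (i == j.+1) -> forall l, (0 < l <= n)%N ->
  (l == j.+1) || (j == l.+1) -> is_path n [:: i; j; l].
Proof. by move=> hi hj ij l hl jl; rewrite /is_path /= hi hj ij hl jl. Qed.

(** A straight path represents no basis element, (n|n-1|n) could only represent [Loop n], which is
    outside the corner, and the two paths of a loop relation count in the same coordinate, so that
    their difference has coordinate 0. *)
Lemma qcoord_rel b (r : kQ) (p q : qpath n) : in_corner n b -> zz_relation r ->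
  qcoord b ((<< p >> : kQ) * r * (<< q >> : kQ)) = 0.
Proof.
move=> hb hr; have pE (s : qpath n) : << s >> = pp (val s) :> kQ by rewrite ppath.unlock valK.
rewrite !pE; case: p q => [p hp] [q hq] /=.
case: hr => [i i0 hi|i i0 hi|i i0 hi|n2].
- have h : is_path n [:: i; i.+1; i.+2] by apply: is_path3; lia.
  rewrite qcoord_ppathMM // qcoord_ppath //.
  case: ifP => // _; rewrite (_ : represents _ _ = false) //.
  by apply: negbTE; case: b hb => j /= hb; rewrite /represents !eqseq_cons /= ?andbF //; lia.
- have h : is_path n [:: i.+2; i.+1; i] by apply: is_path3; lia.
  rewrite qcoord_ppathMM // qcoord_ppath //.
  case: ifP => // _; rewrite (_ : represents _ _ = false) //.
  by apply: negbTE; case: b hb => j /= hb; rewrite /represents !eqseq_cons /= ?andbF //; lia.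
- have h : is_path n [:: i; i.+1; i] by apply: is_path3; lia.
  have h' : is_path n [:: i; i.-1; i] by apply: is_path3; lia.
  rewrite mulrBr mulrBl qcoordB !qcoord_ppathMM //=; case: ifP => _; last by rewrite subr0.
  rewrite !qcoord_ppath // (_ : represents _ _ = represents b [:: i; i.-1; i]) ?subrr //.
  by case: b hb => j /= hb; rewrite /represents !eqseq_cons /= ?andbF //; lia.
- have h : is_path n [:: n; n.-1; n] by apply: is_path3; lia.
  rewrite qcoord_ppathMM // qcoord_ppath //.
  case: ifP => // _; rewrite (_ : represents _ _ = false) //.
  by apply: negbTE; case: b hb => j /= hb; rewrite /represents !eqseq_cons /= ?andbF //; lia.
Qed.

Lemma qcoord_ideal b (x : kQ) : in_corner n b -> x \in @zz_ideal k n -> qcoord b x = 0.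
Proof.
move=> hb /asboolP; elim=> [|c r d {}x hr _ IH]; first exact: qcoord0.
rewrite -[c * r * d]scale1r qcoordP IH addr0 mul1r => {IH}.
(* Expanding both outer factors into paths reduces the claim to [qcoord_rel]. *)
elim/pathalg_ind: c => [|a p c IHc]; first by rewrite !mul0r qcoord0.
rewrite !mulrDl -!pathalgZAl qcoordP IHc addr0.
rewrite [X in a * X](_ : _ = 0) ?mulr0 // => {IHc}.
elim/pathalg_ind: d => [|e q d IHd]; first by rewrite mulr0 qcoord0.
by rewrite [in qcoord b _]mulrDr -pathalgZAr qcoordP IHd addr0 qcoord_rel // mulr0.
Qed.

End PathAlgebraCoordinates.

(** * Coordinates and normal forms in C_{n-1} *)

Section ZigzagCoordinates.
Variables (k : fieldType) (n : nat).
Local Notation C := (zigzag k n).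
Local Notation kpath := (zpath k n).
Local Notation pp := (ppath k n).

(** For [b] in the corner the chosen representative does not matter, because [qcoord b] vanishes on
    the ideal; see [zcoord_pi]. *)
Definition zcoord (b : zz_basis) (x : C) : k := qcoord b (repr (zz_val x)).

Lemma zcoord_pi b x (g : pathalg k n) : in_corner n b -> zz_val x = zz_pi g ->
  zcoord b x = qcoord b g.
Proof.
move=> hb e; apply/eqP; rewrite -subr_eq0 -qcoordB; apply/eqP/qcoord_ideal => //.
by rewrite -zz_piE zz_repr e.
Qed.

Lemma zcoordP b a x y : in_corner n b -> zcoord b (a *: x + y) = a * zcoord b x + zcoord b y.
Proof.
move=> hb; rewrite -qcoordP; apply: zcoord_pi => //.
by rewrite zz_piD zz_pi_scale !zz_repr.
Qed.

Lemma zz_pi0 : zz_pi (0 : pathalg k n) = 0.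
Proof.
have /eqP := zz_piD (0 : pathalg k n) 0; rewrite addr0.
by rewrite -subr_eq0 opprD addrA subrr add0r oppr_eq0 => /eqP.
Qed.

Lemma zz_eM s : is_path n s ->
  zz_e k n * zz_pi (pp s) = if (head 0 s < n)%N then zz_pi (pp s) else 0.
Proof.
move=> hs; rewrite -zz_pi_mul mulr_suml.
have hi : (0 < head 0 s <= n)%N by case: (s) hs => // b t /and3P[_ /andP[]].
rewrite (eq_big_nat _ _ (F2 := fun i => if i == head 0%N s then pp s else 0)).
  rewrite -big_mkcond big_nat1_eq.
  by case: ifP => h1; case: ifP => // h2; rewrite ?zz_pi0 //; lia.
move=> i h; rewrite ppathM ?is_path1 //=; last by lia.
by case: eqP => // ->; case: (s) hs.
Qed.

Lemma zz_Me s : is_path n s ->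
  zz_pi (pp s) * zz_e k n = if (last 0 s < n)%N then zz_pi (pp s) else 0.
Proof.
move=> hs; rewrite -zz_pi_mul mulr_sumr.
have hi : (0 < last 0 s <= n)%N.
  by case: (s) hs => // b t /and3P[_ /allP h _]; apply/h/mem_last.
rewrite (eq_big_nat _ _ (F2 := fun i => if i == last 0%N s then pp s else 0)).
  rewrite -big_mkcond big_nat1_eq.
  by case: ifP => h1; case: ifP => // h2; rewrite ?zz_pi0 //; lia.
by move=> i h; rewrite ppathM ?is_path1 //= ?cats0 1?eq_sym //; lia.
Qed.

Lemma val_zpath s : is_path n s ->
  zz_val (kpath s) = if (head 0 s < n)%N && (last 0 s < n)%N then zz_pi (pp s) else 0.
Proof.
move=> hs; rewrite /= zz_eM //; case: ifP => _ /=; last by rewrite mul0r.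
by rewrite zz_Me.
Qed.

Lemma zpath_val_eq s t : is_path n s -> is_path n t -> head 0%N s = head 0%N t ->
  last 0%N s = last 0%N t -> zz_pi (pp s) = zz_pi (pp t) -> kpath s = kpath t.
Proof.
move=> hs ht e1 e2 e; apply: val_inj.
by rewrite [LHS]val_zpath // [RHS]val_zpath // e1 e2 e.
Qed.

(** A factor ending at n has class 0 in C_{n-1} even when the concatenated path does not, as for
    (n-1|n) and (n|n-1); hence the bound on the middle vertex. *)
Lemma zpathM s t : is_path n s -> is_path n t ->
  kpath s * kpath t =
  if (last 0%N s == head 0%N t) && (last 0 s < n)%N then kpath (s ++ behead t) else 0.
Proof.
move=> hs ht; apply: val_inj.
have -> : val (kpath s * kpath t) = zz_val (kpath s) * zz_val (kpath t) by [].
rewrite !val_zpath //.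
have [e|ne] /= := eqVneq (last 0%N s) (head 0%N t); last first.
  case: ifP => _; last by rewrite mul0r.
  case: ifP => _; last by rewrite mulr0.
  by rewrite -zz_pi_mul ppathM // (negbTE ne) zz_pi0.
case: (ltnP (last 0%N s) n) => h; last by rewrite andbF mul0r.
rewrite [RHS]val_zpath ?is_path_cat // last_cat -e h andbT.
have -> : head 0%N (s ++ behead t) = head 0%N s by case: (s) hs.
have -> : last (last 0%N s) (behead t) = last 0%N t by case: (t) ht e => //= ? ? _ ->.
case: ifP => _; last by rewrite mul0r.
case: ifP => _; last by rewrite mulr0.
by rewrite -zz_pi_mul ppathM // e eqxx.
Qed.

Lemma zz_rel_pi0 (r : pathalg k n) : zz_relation r -> zz_pi r = 0.
Proof.
move=> hr; rewrite -zz_pi0; apply/eqP; rewrite zz_piE subr0; apply/asboolP.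
by rewrite -[r]mul1r -[1 * r]mulr1 -[X in zz_span X]addr0; constructor => //; constructor.
Qed.

Lemma zz_pi_path3 a b c : is_path n [:: a; b; c] -> a != c -> zz_pi (pp [:: a; b; c]) = 0.
Proof.
case/and3P=> _ /= /and4P[ha hb hc _] /and3P[/orP[]/eqP e /orP[]/eqP e' _] ne; subst.
- by apply/zz_rel_pi0/RelUp; lia.
- by case: e' ne => ->; rewrite eqxx.
- by rewrite eqxx in ne.
- by apply/zz_rel_pi0/RelDown; lia.
Qed.

Lemma zz_pi_loop i : (2 <= i)%N -> (i <= n.-1)%N ->
  zz_pi (pp [:: i; i.-1; i]) = zz_pi (pp [:: i; i.+1; i]).
Proof.
move=> h1 h2; apply/eqP; rewrite eq_sym zz_piE; apply/asboolP.
rewrite -[X in zz_span X]addr0 -[X in X + 0]mul1r -[X in X + 0]mulr1.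
by constructor; [apply: RelLoop | constructor].
Qed.

Lemma zz_pi_cat s t : is_path n s -> is_path n t -> last 0%N s = head 0%N t ->
  zz_pi (pp (s ++ behead t)) = zz_pi (pp s) * zz_pi (pp t).
Proof. by move=> hs ht e; rewrite -zz_pi_mul ppathM // e eqxx. Qed.

(** A straight three-vertex piece kills the path at once. Otherwise it runs back and forth along one
    edge and contains a loop at the upper vertex going down: this loop is zero at n, and elsewhere
    the loop relation turns it upwards, which creates a straight piece. *)
Lemma zz_pi_path4 a b c d : is_path n [:: a; b; c; d] -> zz_pi (pp [:: a; b; c; d]) = 0.
Proof.
case/and3P=> _ /= /and5P[ha hb hc hd _] /and4P[hab hbc hcd _].
have h1 : is_path n [:: a; b; c] by apply: is_path3.
have h2 : is_path n [:: b; c; d] by apply: is_path3.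
have p2 x y : (0 < x <= n)%N -> (0 < y <= n)%N ->
    (y == x.+1) || (x == y.+1) -> is_path n [:: x; y].
  by move=> hx hy xy; rewrite /is_path /= hx hy xy.
have E1 : zz_pi (pp [:: a; b; c; d]) = zz_pi (pp [:: a; b; c]) * zz_pi (pp [:: c; d]).
  by rewrite -zz_pi_cat // p2.
have E2 : zz_pi (pp [:: a; b; c; d]) = zz_pi (pp [:: a; b]) * zz_pi (pp [:: b; c; d]).
  by rewrite -zz_pi_cat // p2.
have [ac|nac] := eqVneq a c; last by rewrite E1 zz_pi_path3 ?mul0r.
have [bd|nbd] := eqVneq b d; last by rewrite E2 zz_pi_path3 ?mulr0.
subst c d; case/orP: hab => /eqP e; subst.
- rewrite E2; have [en|nb] := eqVneq a.+1 n.
    by rewrite [X in _ * X](_ : _ = 0) ?mulr0 //; apply: zz_rel_pi0; subst; apply: RelEnd; lia.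
  rewrite (zz_pi_loop (i := a.+1)); [| lia | lia].
  have <- : zz_pi (pp [:: a; a.+1; a.+2]) * zz_pi (pp [:: a.+2; a.+1]) =
         zz_pi (pp [:: a; a.+1]) * zz_pi (pp [:: a.+1; a.+2; a.+1]).
    by rewrite -!zz_pi_cat //; (apply: is_path3 || apply: p2); lia.
  by rewrite zz_pi_path3 ?mul0r //; first apply: is_path3; lia.
- rewrite E1; have [en|nb] := eqVneq b.+1 n.
    by rewrite [X in X * _](_ : _ = 0) ?mul0r //; apply: zz_rel_pi0; subst; apply: RelEnd; lia.
  rewrite (zz_pi_loop (i := b.+1)); [| lia | lia].
  have <- : zz_pi (pp [:: b.+1; b.+2]) * zz_pi (pp [:: b.+2; b.+1; b]) =
         zz_pi (pp [:: b.+1; b.+2; b.+1]) * zz_pi (pp [:: b.+1; b]).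
    by rewrite -!zz_pi_cat //; (apply: is_path3 || apply: p2); lia.
  by rewrite zz_pi_path3 ?mulr0 //; first apply: is_path3; lia.
Qed.

Lemma zpath_ind (P : C -> Prop) :
  P 0 -> (forall a (p : qpath n) x, P x -> P (a *: kpath (val p) + x)) -> forall x, P x.
Proof.
move=> P0 PD x.
have /asboolP[a ex] := zz_valP x.
suff H g : P (Zigzag (zz_cornerP (zz_pi g : zzA k n))).
  have := H (repr a); congr P; apply: val_inj; rewrite /= ex.
  by rewrite zz_repr.
elim/pathalg_ind: g => [|c p g IH].
  by move: P0; congr P; apply: val_inj; rewrite /= zz_pi0 mulr0 mul0r.
move: (PD c p _ IH); congr P; apply: val_inj.
rewrite /= ppath.unlock valK zz_piD zz_pi_scale mulrDr mulrDl.
by rewrite -zzA_scalerAr -zzA_scalerAl.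
Qed.

Definition bpath (b : zz_basis) : C := kpath (word b).
Definition opath (o : option zz_basis) : C := if o is Some b then bpath b else 0.

Lemma nf_some s b : is_path n s -> nf n s = Some b ->
  [/\ in_corner n b, bsrc b = head 0%N s & btgt b = last 0%N s].
Proof.
rewrite /nf; case: ifP => // /andP[h1 h2].
case: s h1 h2 => [//|i [|j [|l [|//]]]] /= h1 h2 /and3P[_ /=].
- by rewrite andbT => hi _ [<-] /=; split => //; lia.
- move=> /and3P[hi hj _] /andP[hij _] [<-]; case: eqP => e; subst.
    by split => //=; lia.
  have e' : i = j.+1 by lia.
  by subst; split => //=; lia.
- move=> /and4P[hi hj hl _] _; case: eqP => // e [<-]; subst.
  by split => //=; lia.
Qed.

Lemma zpath_out s : is_path n s -> ~~ ((head 0 s < n)%N && (last 0 s < n)%N) -> kpath s = 0.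
Proof. by move=> hs h; apply: val_inj; rewrite [LHS]val_zpath // (negbTE h). Qed.

Lemma zpath0 s : is_path n s -> zz_pi (pp s) = 0 -> kpath s = 0.
Proof. by move=> hs h; apply: val_inj; rewrite [LHS]val_zpath // h if_same. Qed.

(** Longer paths have a prefix of four vertices, which is zero; three vertices with distinct ends
    form a relation; and (i|i-1|i) is exchanged for (i|i+1|i) by the loop relation, available since
    the ends lie below n. *)
Lemma zpath_nf s : is_path n s -> kpath s = opath (nf n s).
Proof.
move=> hs; rewrite /nf; case: ifP => [/andP[h1 h2]|/negbT h]; last exact: zpath_out.
case: s hs h1 h2 => [//|a [//|b [|c [|d s]]]] hs /= h1 h2.
- case/and3P: hs => _ _ /= /andP[/orP[]/eqP e _]; subst; first by rewrite eqxx.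
  by case: eqP => // e; lia.
- case: eqP => [e|/eqP ne]; last by apply: zpath0 => //; exact: zz_pi_path3.
  subst c; case/and3P: (hs) => _ /= /and4P[ha hb _ _] /andP[/orP[]/eqP e _]; subst => //.
  apply: zpath_val_eq => //; first by apply: is_path3; lia.
  by have := @zz_pi_loop b.+1; apply; lia.
- apply: zpath0 => //.
  have e : [:: a, b, c, d & s] = [:: a; b; c; d] ++ behead (d :: s) by [].
  case/and3P: (hs) => _; rewrite {1}e all_cat => /andP[h4 hs4].
  rewrite /= => /and4P[ab bc cd ps].
  have p4 : is_path n [:: a; b; c; d] by rewrite /is_path h4 /= ab bc cd.
  have ps4 : is_path n (d :: s).
    by apply/and3P; split => //; move: h4 hs4 => /= /and5P[_ _ _ -> _].
  by rewrite e zz_pi_cat // zz_pi_path4 // mul0r.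
Qed.

Lemma val_bpath b : in_corner n b -> zz_val (bpath b) = zz_pi (pp (word b)).
Proof.
move=> hb; rewrite val_zpath ?in_corner_path // (_ : _ && _) //.
by case: b hb => i /= h; lia.
Qed.

Lemma represents_word b b' : represents b (word b') = (b == b').
Proof.
rewrite /represents (inj_eq word_inj) eq_sym; case: b => i; rewrite ?orbF //.
case: eqP => //= ne; apply/negP; case: b' ne => j //= ne; rewrite !eqseq_cons ?andbF //.
by case/and4P; lia.
Qed.

(** No basis word has the form (i|i-1|i), so each coordinate detects only its own word. This duality
    makes the path classes linearly independent. *)
Lemma zcoord_bpath b b' : in_corner n b -> in_corner n b' -> zcoord b (bpath b') = (b == b')%:R.
Proof.
move=> hb hb'; rewrite (zcoord_pi hb (val_bpath hb')).
by rewrite qcoord_ppath ?in_corner_path // represents_word.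
Qed.

Lemma zcoord0 b : in_corner n b -> zcoord b 0 = 0.
Proof. by move=> hb; have := zcoordP (-1) 0 0 hb; rewrite scaler0 addr0 mulN1r addNr. Qed.

Lemma zcoordD b x y : in_corner n b -> zcoord b (x + y) = zcoord b x + zcoord b y.
Proof. by move=> hb; have := zcoordP 1 x y hb; rewrite scale1r mul1r. Qed.

Lemma zcoordB b x y : in_corner n b -> zcoord b (x - y) = zcoord b x - zcoord b y.
Proof. by move=> hb; have := zcoordP (-1) y x hb; rewrite scaleN1r mulN1r addrC [RHS]addrC. Qed.

(** Every element is a combination of classes of paths, and normal forms reduce these to basis
    elements, which therefore span. *)
Lemma corner_basis_ind (P : C -> Prop) :
  P 0 -> (forall a b x, in_corner n b -> P x -> P (a *: bpath b + x)) -> forall x, P x.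
Proof.
move=> P0 PD; apply: zpath_ind => // a [s hs] x Px /=; rewrite zpath_nf //.
case e: (nf n s) => [b|] /=; last by rewrite scaler0 add0r.
by apply: PD => //; have [] := nf_some hs e.
Qed.

Lemma zcoord_pick (g : zz_basis -> C) b : in_corner n b ->
  \sum_(c <- corner_basis n) zcoord c (bpath b) *: g c = g b.
Proof.
move=> hb; rewrite (bigD1_seq b) ?mem_corner_basis ?corner_basis_uniq //=.
rewrite zcoord_bpath // eqxx scale1r.
rewrite big_seq_cond big1 ?addr0 // => c /andP[]; rewrite mem_corner_basis => hc /negbTE ne.
by rewrite zcoord_bpath // ne scale0r.
Qed.

End ZigzagCoordinates.

(** * Tables of the product and of m_3 on the path basis *)

Definition mul_basis (b c : zz_basis) : option zz_basis :=
  match b, c with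
  | Vtx i, c => if bsrc c == i then Some c else None
  | b, Vtx i => if btgt b == i then Some b else None
  | Up i, Down j => if i == j then Some (Loop i) else None
  | Down i, Up j => if i == j then Some (Loop i.+1) else None
  | _, _ => None
  end.

Section Products.
Variables (k : fieldType) (n : nat).
Local Notation C := (zigzag k n).
Local Notation bpath := (bpath k n).
Local Notation opath := (opath k n).

Lemma in_corner_src b : in_corner n b -> (0 < bsrc b < n)%N.
Proof. by case: b => i /= h; rewrite /bsrc /=; lia. Qed.

Lemma in_corner_tgt b : in_corner n b -> (0 < btgt b < n)%N.
Proof. by case: b => i /= h; rewrite /btgt /=; lia. Qed.

(** The product is the class of the concatenated word, brought to normal form. For [Down i] and
    [Up i] this word is (i+1|i|i+1), with normal form [Loop i.+1]. *)
Lemma bpathM b c : in_corner n b -> in_corner n c -> bpath b * bpath c = opath (mul_basis b c).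
Proof.
move=> hb hc; have pb := in_corner_path hb; have pc := in_corner_path hc.
rewrite [LHS](zpathM k pb pc) -/(btgt b) -/(bsrc c).
have /andP[_ tb] := in_corner_tgt hb; rewrite tb andbT.
case: eqP => [e|ne].
  rewrite zpath_nf ?is_path_cat //; congr opath; rewrite /nf.
  have -> : head 0%N (word b ++ behead (word c)) = bsrc b by case: b {hb pb tb e}.
  have -> : last 0%N (word b ++ behead (word c)) = btgt c.
    by rewrite last_cat -/(btgt b) e; case: (c).
  have /andP[_ ->] := in_corner_src hb; have /andP[_ ->] := in_corner_tgt hc.
  by case: b c e hb hc {pb pc tb} => i [] j; rewrite /bsrc /btgt /= => e hb hc; subst; 
     rewrite ?eqxx //; do ?[case: eqP => ? //]; try lia.
case: b c ne {hb hc pb pc tb} => i [] j; rewrite /bsrc /btgt /= => ne;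
     do ?[case: eqP => ? //]; subst => //.
Qed.

End Products.

(* Down i is the arrow (i+1|i), so the second and third rule of m_3 occur here
   with i-1 instead of i. *)
Definition m3_basis (a b c : zz_basis) : option zz_basis :=
  match a, b, c with
  | Up i, Down j, Loop l => if (i == j) && (i == l) then Some (Loop i) else None
  | Up i, Down j, Up l => if (i == j) && (i == l) then Some (Up i) else None
  | Loop i, Down j, Up l => if (i == j.+1) && (j == l) then Some (Loop i) else None
  | _, _, _ => None
  end.

Definition bdeg (b : zz_basis) : nat := desc (word b).

Lemma bdegE b : bdeg b = if b is (Down _ | Loop _) then 1%N else 0%N.
Proof. by case: b => i; rewrite /bdeg /desc unlock /=; lia. Qed.

Lemma in_corner_mul n b c d : in_corner n b -> in_corner n c ->
  mul_basis b c = Some d -> in_corner n d.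
Proof.
move=> hb hc; case: b c hb hc => i [] j /= hb hc //=; case: eqP => // e [<-] //=; subst; lia.
Qed.

(** These facts make m_3 a relative cochain of degree -1; the degree law is written with [+ 1] on
    the right to avoid subtraction in [nat]. *)
Lemma m3_basisP n a b c d : in_corner n a -> in_corner n b -> in_corner n c ->
  m3_basis a b c = Some d ->
  [/\ in_corner n d, bsrc d = bsrc a /\ btgt d = btgt c, btgt a = bsrc b, btgt b = bsrc c
    & (bdeg a + bdeg b + bdeg c = bdeg d + 1)%N].
Proof.
rewrite !bdegE; case: a b c => i [] j [] l //= hi hj hl;
  case: andP => // -[/eqP ? /eqP ?] [<-]; subst; by split => //=; lia.
Qed.

Lemma m3_rule_basis n s t u v : m3_rule n s t u v -> exists a b c d,
  [/\ [/\ in_corner n a, in_corner n b & in_corner n c],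
    [/\ s = word a, t = word b, u = word c & v = word d] & m3_basis a b c = Some d].
Proof.
case=> i h1 h2.
- by exists (Up i), (Down i), (Loop i), (Loop i); rewrite /= !eqxx; do ?split => //; lia.
- case: i h1 h2 => // i h1 h2.
  by exists (Up i), (Down i), (Up i), (Up i); rewrite /= !eqxx; do ?split => //; lia.
- case: i h1 h2 => // i h1 h2.
  by exists (Loop i.+1), (Down i), (Up i), (Loop i.+1); rewrite /= !eqxx; do ?split => //; lia.
Qed.

Lemma m3_basis_rule n a b c d : in_corner n a -> in_corner n b -> in_corner n c ->
  m3_basis a b c = Some d -> m3_rule n (word a) (word b) (word c) (word d).
Proof.
case: a b c => i [] j [] l //= hi hj hl; case: andP => // -[/eqP ? /eqP ?] [<-]; subst => /=.
- by apply: (@M3Rule2 n l.+1); lia.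
- by apply: M3Rule1; lia.
- by apply: (@M3Rule3 n l.+1); lia.
Qed.

(** * Trilinear extension of m_3 and its cocycle identity *)

Section TrilinearExtension.
Variables (k : fieldType) (n : nat).
Local Notation C := (zigzag k n).
Local Notation bpath := (bpath k n).
Local Notation opath := (opath k n).

Definition klinear (f : C -> C) : Prop := forall a x y, f (a *: x + y) = a *: f x + f y.

Lemma klinearD f g : klinear f -> klinear g -> klinear (fun x => f x + g x).
Proof. by move=> lf lg a x y; rewrite lf lg scalerDr addrACA. Qed.
Lemma klinearN f : klinear f -> klinear (fun x => - f x).
Proof. by move=> lf a x y; rewrite lf opprD scalerN. Qed.
Lemma klinear_comp f g : klinear f -> klinear g -> klinear (fun x => f (g x)).
Proof. by move=> lf lg a x y; rewrite lg lf. Qed.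
Lemma klinearMl y : klinear (fun x => x * y).
Proof. by move=> a x x'; rewrite mulrDl zigzag_scalerAl. Qed.
Lemma klinearMr y : klinear (fun x => y * x).
Proof. by move=> a x x'; rewrite mulrDr zigzag_scalerAr. Qed.
Lemma klinear0 f : klinear f -> f 0 = 0.
Proof. by move=> lf; have := lf (-1) 0 0; rewrite scaler0 addr0 scaleN1r addNr. Qed.

Lemma klinear_eq0 f : klinear f ->
  (forall b, in_corner n b -> f (bpath b) = 0) -> forall x, f x = 0.
Proof.
move=> lf f0; apply: corner_basis_ind => [|a b x hb e]; first exact: klinear0.
by rewrite lf f0 // e scaler0 addr0.
Qed.

Definition trilin (f : zz_basis -> zz_basis -> zz_basis -> C) (x y z : C) : C :=
  \sum_(a <- corner_basis n) zcoord a x *: \sum_(b <- corner_basis n) zcoord b y *: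
    \sum_(c <- corner_basis n) zcoord c z *: f a b c.

Lemma klinear_zcoord_sum (g : zz_basis -> C) :
  klinear (fun x => \sum_(a <- corner_basis n) zcoord a x *: g a).
Proof.
move=> a x y; rewrite scaler_sumr -big_split /= big_seq [RHS]big_seq.
apply: eq_bigr => b; rewrite mem_corner_basis => hb.
by rewrite zcoordP // scalerDl scalerA.
Qed.

Lemma klinear_sum (g : zz_basis -> C -> C) (s : seq zz_basis) :
  (forall b, klinear (g b)) -> klinear (fun x => \sum_(b <- s) g b x).
Proof.
move=> lg a x y; rewrite scaler_sumr -big_split /=.
by apply: eq_bigr => b _; rewrite lg.
Qed.

Lemma klinearZ (c : k) f : klinear f -> klinear (fun x => c *: f x).
Proof. by move=> lf a x y; rewrite lf scalerDr !scalerA mulrC. Qed.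

Lemma trilin1 f y z : klinear (fun x => trilin f x y z).
Proof. exact: klinear_zcoord_sum. Qed.
Lemma trilin2 f x z : klinear (fun y => trilin f x y z).
Proof. by apply: klinear_sum => a; apply: klinearZ; apply: klinear_zcoord_sum. Qed.
Lemma trilin3 f x y : klinear (fun z => trilin f x y z).
Proof.
apply: klinear_sum => a; apply: klinearZ.
by apply: klinear_sum => b; apply: klinearZ; apply: klinear_zcoord_sum.
Qed.

Lemma trilin_bpath f a b c : in_corner n a -> in_corner n b -> in_corner n c ->
  trilin f (bpath a) (bpath b) (bpath c) = f a b c.
Proof. by move=> ha hb hc; rewrite /trilin !zcoord_pick. Qed.

Definition m3_lin := trilin (fun a b c => opath (m3_basis a b c)).

Lemma m3_lin_bpath a b c : in_corner n a -> in_corner n b -> in_corner n c ->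
  m3_lin (bpath a) (bpath b) (bpath c) = opath (m3_basis a b c).
Proof. exact: trilin_bpath. Qed.

(** The Hochschild differential of m_3 with its four arguments kept separate, matching the
    right-hand side of [hochd3E]. *)
Definition d_m3_lin w x y z : C :=
  w * m3_lin x y z - m3_lin (w * x) y z + m3_lin w (x * y) z
  - m3_lin w x (y * z) + m3_lin w x y * z.

Lemma bpathMo a b : in_corner n a -> (forall e, b = Some e -> in_corner n e) ->
  bpath a * opath b = opath (obind (mul_basis a) b).
Proof. by move=> ha; case: b => [b|] hb /=; rewrite ?mulr0 ?bpathM //; apply: hb. Qed.

Lemma opathM a b : (forall e, a = Some e -> in_corner n e) -> in_corner n b ->
  opath a * bpath b = opath (obind (mul_basis^~ b) a).
Proof. by case: a => [a|] ha hb /=; rewrite ?mul0r ?bpathM //; apply: ha. Qed.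

Lemma d_m3_lin_bpath (char2 : 2%N \in [pchar k]) a b c d :
  in_corner n a -> in_corner n b -> in_corner n c -> in_corner n d ->
  d_m3_lin (bpath a) (bpath b) (bpath c) (bpath d) = 0.
Proof.
move=> ha hb hc hd; rewrite /d_m3_lin !m3_lin_bpath // !bpathM //.
have e1 : m3_lin (opath (mul_basis a b)) (bpath c) (bpath d) =
    opath (obind (fun e => m3_basis e c d) (mul_basis a b)).
  case e: (mul_basis a b) => [x|]; last exact: (klinear0 (trilin1 _ _ _)).
  by rewrite m3_lin_bpath //; apply: in_corner_mul e.
have e2 : m3_lin (bpath a) (opath (mul_basis b c)) (bpath d) =
    opath (obind (fun e => m3_basis a e d) (mul_basis b c)).
  case e: (mul_basis b c) => [x|]; last exact: (klinear0 (trilin2 _ _ _)).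
  by rewrite m3_lin_bpath //; apply: in_corner_mul e.
have e3 : m3_lin (bpath a) (bpath b) (opath (mul_basis c d)) =
    opath (obind (fun e => m3_basis a b e) (mul_basis c d)).
  case e: (mul_basis c d) => [x|]; last exact: (klinear0 (trilin3 _ _ _)).
  by rewrite m3_lin_bpath //; apply: in_corner_mul e.
rewrite e1 e2 e3 bpathMo //; last by move=> e /(m3_basisP hb hc hd)[].
rewrite opathM //; last by move=> e /(m3_basisP ha hb hc)[].
have oppC (x : C) : - x = x.
  have z2 : x + x = 0 by rewrite -mulr2n -scaler_nat (pcharf0 char2) scale0r.
  by apply/eqP; rewrite eq_sym -addr_eq0 z2.
have addC (x : C) : x + x = 0 by rewrite -[X in X + _]oppC addNr.
rewrite !oppC {e1 e2 e3 ha hb hc hd}.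
(* The split runs over the four shapes and the index equalities in the tables. Either the surviving
   terms cancel in pairs or the index conditions are contradictory. *)
case: a b c d => i [] j [] l [] m; rewrite /bsrc /btgt /=;
  rewrite ?addr0 //; repeat (case: eqP => ? /=; subst; rewrite ?addr0 ?add0r ?addC //).
all: by exfalso; lia.
Qed.

Lemma d_m3_lin_eq0 (char2 : 2%N \in [pchar k]) w x y z : d_m3_lin w x y z = 0.
Proof.
have l1 := trilin1; have l2 := trilin2; have l3 := trilin3.
(* The arguments are reduced to basis elements one at a time; the five goals of each round are the
   linearity of the five terms. *)
move: w; apply: klinear_eq0 => [|a ha].
  rewrite /d_m3_lin; do !apply: klinearD; try apply: klinearN.
  - exact: klinearMl.
  - exact: (klinear_comp (l1 _ y z) (klinearMl x)).
  - exact: l1.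
  - exact: l1.
  - exact: (klinear_comp (klinearMl z) (l1 _ x y)).
move: x; apply: klinear_eq0 => [|b hb].
  rewrite /d_m3_lin; do !apply: klinearD; try apply: klinearN.
  - exact: (klinear_comp (klinearMr _) (l1 _ y z)).
  - exact: (klinear_comp (l1 _ y z) (klinearMr _)).
  - exact: (klinear_comp (l2 _ _ z) (klinearMl _)).
  - exact: l2.
  - exact: (klinear_comp (klinearMl z) (l2 _ _ y)).
move: y; apply: klinear_eq0 => [|c hc].
  rewrite /d_m3_lin; do !apply: klinearD; try apply: klinearN.
  - exact: (klinear_comp (klinearMr _) (l2 _ _ z)).
  - exact: l2.
  - exact: (klinear_comp (l2 _ _ z) (klinearMr _)).
  - exact: (klinear_comp (l3 _ _ _) (klinearMl _)).
  - exact: (klinear_comp (klinearMl z) (l3 _ _ _)).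
move: z; apply: klinear_eq0 => [|d hd].
  rewrite /d_m3_lin; do !apply: klinearD; try apply: klinearN.
  - exact: (klinear_comp (klinearMr _) (l3 _ _ _)).
  - exact: l3.
  - exact: l3.
  - exact: (klinear_comp (l3 _ _ _) (klinearMr _)).
  - exact: klinearMr.
exact: d_m3_lin_bpath.
Qed.

End TrilinearExtension.

(** * m_3 as a multilinear map on triples, and its uniqueness *)

Section Main.
Variables (k : fieldType) (n : nat).
Local Notation C := (zigzag k n).
Local Notation kpath := (zpath k n).
Local Notation bpath := (bpath k n).
Local Notation opath := (opath k n).
Local Notation m3_lin := (@m3_lin k n).
Local Notation o1 := (@Ordinal 3 1 isT).

Lemma tuple3_eta (T : Type) (t : 3.-tuple T) : t = [tuple tnth t ord0; tnth t o1; tnth t ord_max].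
Proof.
by apply: eq_from_tnth => -[[|[|[|//]]] h]; rewrite [RHS](tnth_nth (tnth t ord0)) /=;
  congr (tnth t _); apply: val_inj.
Qed.

Definition m3_map (t : 3.-tuple C) : C := m3_lin (tnth t ord0) (tnth t o1) (tnth t ord_max).

Lemma m3_mapE x y z : m3_map [tuple x; y; z] = m3_lin x y z.
Proof. by []. Qed.

Lemma hochd3E (m : 3.-tuple C -> C) (w x y z : C) :
  hochd m [tuple w; x; y; z] =
  w * m [tuple x; y; z] - m [tuple w * x; y; z] + m [tuple w; x * y; z]
  - m [tuple w; x; y * z] + m [tuple w; x; y] * z.
Proof.
rewrite /hochd !big_ord_recl big_ord0 /= addr0 !exprS expr0 !mulr1 !mulrN1 !opprK.
rewrite !mulN1r ?opprK !mul1r !addrA.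
by do 4?congr (_ + _); rewrite ?mulN1r; do ?congr (- _); do ?congr (_ * _);
  congr m; apply: eq_from_tnth => -[[|[|[|//]]] ?]; rewrite !tnth_mktuple.
Qed.

Lemma tset3 (x y z : C) :
  [/\ forall w, tset [tuple x; y; z] ord0 w = [tuple w; y; z],
      forall w, tset [tuple x; y; z] o1 w = [tuple x; w; z] &
      forall w, tset [tuple x; y; z] ord_max w = [tuple x; y; w]].
Proof. by split=> w; apply: eq_from_tnth => -[[|[|[|//]]] ?]; rewrite !tnth_mktuple. Qed.

Lemma tset2 (x y : C) :
  (forall w, tset [tuple x; y] ord0 w = [tuple w; y]) /\
  (forall w, tset [tuple x; y] ord_max w = [tuple x; w]).
Proof. by split=> w; apply: eq_from_tnth => -[[|[|//]] ?]; rewrite !tnth_mktuple. Qed.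

Lemma multilinear3P (m : 3.-tuple C -> C) : multilinear m <->
  [/\ forall y z, klinear (fun x => m [tuple x; y; z]),
      forall x z, klinear (fun y => m [tuple x; y; z]) &
      forall x y, klinear (fun z => m [tuple x; y; z])].
Proof.
split=> [mm|[l1 l2 l3] t i a x y].
  split=> [y z|x z|x y] a u v.
  - by have [t1 _ _] := tset3 0 y z; have := mm [tuple 0; y; z] ord0 a u v; rewrite !t1.
  - by have [_ t2 _] := tset3 x 0 z; have := mm [tuple x; 0; z] o1 a u v; rewrite !t2.
  - by have [_ _ t3] := tset3 x y 0; have := mm [tuple x; y; 0] ord_max a u v; rewrite !t3.
rewrite (tuple3_eta t); move: (tnth t _) (tnth t _) (tnth t _) => z' y' x'.
have [t1 t2 t3] := tset3 x' y' z'.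
have : [|| i == ord0, i == o1 | i == ord_max] by case: i => -[|[|[|//]]] h.
by case/or3P => /eqP ->; rewrite ?t1 ?t2 ?t3 ?l1 ?l2 ?l3.
Qed.

Lemma multilinear_eq (f g : 3.-tuple C -> C) : multilinear f -> multilinear g ->
  (forall a b c, in_corner n a -> in_corner n b -> in_corner n c ->
     f [tuple bpath a; bpath b; bpath c] = g [tuple bpath a; bpath b; bpath c]) -> f = g.
Proof.
move=> /multilinear3P[f1 f2 f3] /multilinear3P[g1 g2 g3] fg.
apply/funext => t; rewrite (tuple3_eta t).
move: (tnth t _) (tnth t _) (tnth t _) => z y x {t}; apply/eqP; rewrite -subr_eq0; apply/eqP.
move: x; apply: (@klinear_eq0 _ _ (fun x => f [tuple x; y; z] - g [tuple x; y; z])) => [|a ha].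
  by apply: klinearD; [exact: f1 | apply: klinearN; exact: g1].
move: y; apply: (@klinear_eq0 _ _ (fun y =>
  f [tuple bpath a; y; z] - g [tuple bpath a; y; z])) => [|b hb].
  by apply: klinearD; [exact: f2 | apply: klinearN; exact: g2].
move: z; apply: (@klinear_eq0 _ _ (fun z =>
  f [tuple bpath a; bpath b; z] - g [tuple bpath a; bpath b; z])) => [|c hc].
  by apply: klinearD; [exact: f3 | apply: klinearN; exact: g3].
by rewrite fg // subrr.
Qed.

Lemma multilinear_m3_map : multilinear m3_map.
Proof. by apply/multilinear3P; split => ? ?; [apply: trilin1|apply: trilin2|apply: trilin3]. Qed.

Lemma is_m3_bpath (m : 3.-tuple C -> C) : is_m3 m -> forall a b c,
  in_corner n a -> in_corner n b -> in_corner n c ->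
  m [tuple bpath a; bpath b; bpath c] = opath (m3_basis a b c).
Proof.
move=> [_ m1 m0] a b c ha hb hc; case e: (m3_basis a b c) => [d|].
  by apply: m1; apply: m3_basis_rule e.
(* Where the table is empty no rule applies, since every rule comes from a table entry and words
   determine basis elements. *)
apply: m0; rewrite ?path_basisE ?(mem_map word_inj) ?mem_corner_basis // => v.
case/m3_rule_basis => a' [b' [c' [d [_ [/word_inj ea /word_inj eb /word_inj ec _]]]]].
by rewrite -ea -eb -ec e.
Qed.

Lemma is_m3_m3_map : is_m3 m3_map.
Proof.
split; first exact: multilinear_m3_map.
  move=> s t u v /m3_rule_basis[a [b [c [d [[ha hb hc] [-> -> -> ->] e]]]]].
  by rewrite m3_mapE m3_lin_bpath // e.
move=> s t u; rewrite path_basisE => /mapP[a ha ->] /mapP[b hb ->] /mapP[c hc ->].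
rewrite !mem_corner_basis in ha hb hc => nv; rewrite m3_mapE m3_lin_bpath //.
by case e: (m3_basis a b c) => [d|//]; case: (nv _ (m3_basis_rule ha hb hc e)).
Qed.

Lemma is_m3_unique (m : 3.-tuple C -> C) : is_m3 m -> m = m3_map.
Proof.
move=> hm; apply: multilinear_eq => [||a b c ha hb hc]; first by case: hm.
  exact: multilinear_m3_map.
by rewrite is_m3_bpath // m3_mapE m3_lin_bpath.
Qed.

Lemma hochd_m3_map (char2 : 2%N \in [pchar k]) : hochd m3_map = 0.
Proof.
apply/funext => t; have -> : t = [tuple tnth t ord0; tnth t (lift ord0 ord0);
    tnth t (lift ord0 (lift ord0 ord0)); tnth t ord_max].
  by apply: eq_from_tnth => -[[|[|[|[|//]]]] h]; rewrite [RHS](tnth_nth (tnth t ord0)) /=;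
  congr (tnth t _); apply: val_inj.
by rewrite hochd3E !m3_mapE; apply: d_m3_lin_eq0.
Qed.

(** * m_3 as a relative cochain of degree -1 *)

Lemma bpath_sandwich b : in_corner n b ->
  bpath b = kpath [:: bsrc b] * bpath b * kpath [:: btgt b].
Proof.
move=> hb; have hs : in_corner n (Vtx (bsrc b)) := in_corner_src hb.
have ht : in_corner n (Vtx (btgt b)) := in_corner_tgt hb.
rewrite -[kpath [:: bsrc b]]/(bpath (Vtx (bsrc b))) -[kpath [:: btgt b]]/(bpath (Vtx (btgt b))).
rewrite bpathM //= eqxx /= bpathM //.
by case: b {hb hs ht} => i; rewrite /= eqxx.
Qed.

(** Normal forms keep the ends of a path, so m_3 is evaluated on zero or on basis elements with the
    same ends. A nonzero value forces composability and is a basis element between the outer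
    ends. *)
Lemma relative_m3_map : relative m3_map.
Proof.
move=> ps; cbv zeta; rewrite (tuple3_eta ps).
have -> p q r : [tuple kpath (val (tnth [tuple p; q; r] j)) | j < 3] =
    [tuple kpath (val p); kpath (val q); kpath (val r)].
  by apply: eq_from_tnth => -[[|[|[|//]]] h]; rewrite tnth_mktuple.
move: (tnth ps _) (tnth ps _) (tnth ps _) => [u hu] [t ht] [s hs].
rewrite m3_mapE (zpath_nf k hs) (zpath_nf k ht) (zpath_nf k hu) /composable /src /tgt /= andbT.
have m3_0l y z : m3_lin 0 y z = 0 by apply: (klinear0 (trilin1 _ _ _)).
have m3_0m x z : m3_lin x 0 z = 0 by apply: (klinear0 (trilin2 _ _ _)).
have m3_0r x y : m3_lin x y 0 = 0 by apply: (klinear0 (trilin3 _ _ _)).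
set v := m3_lin _ _ _.
suff [->|[d [e1 e2 e3 e4 [-> hd]]]] : v = 0 \/
   exists d, [/\ last 0%N s = head 0%N t, last 0%N t = head 0%N u,
     bsrc d = head 0%N s, btgt d = last 0%N u & v = bpath d /\ in_corner n d].
(* The value zero fits both cases: for composable paths it is the sandwich with middle factor 0. *)
- by case: ifP => // _; exists 0; rewrite mulr0 mul0r.
- by rewrite e1 e2 !eqxx; exists (bpath d); rewrite -e3 -e4 -bpath_sandwich.
rewrite /v; case ea: (nf n s) => [a|] /=; last by left.
case eb: (nf n t) => [b|] /=; last by left.
case ec: (nf n u) => [c|] /=; last by left.
have [ha sa ta] := nf_some hs ea; have [hb sb tb] := nf_some ht eb.
have [hc sc tc] := nf_some hu ec.
rewrite m3_lin_bpath //; case e: (m3_basis a b c) => [d|]; last by left.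
right; exists d; have [hd [e1 e2] e3 e4 _] := m3_basisP ha hb hc e.
by split => //; congruence.
Qed.

Lemma zdegZ d a (x : C) : zdeg d x -> zdeg d (a *: x).
Proof.
move=> [g hg ex]; exists (a *: g) => [p|]; last by rewrite /= ex zz_pi_scale.
by move/(fsubsetP (msuppZ_le _ _)); apply: hg.
Qed.

Lemma zdegD d (x y : C) : zdeg d x -> zdeg d y -> zdeg d (x + y).
Proof.
move=> hx hy; rewrite -[y]opprK; apply: zdegB => //.
by rewrite -[- y]add0r; apply: zdegB => //; exact: zdeg0.
Qed.

Lemma zdeg_bpath b : in_corner n b -> zdeg (bdeg b) (bpath b).
Proof.
move=> hb; exists (ppath k n (word b)); last by rewrite [LHS]val_bpath.
move=> p; rewrite ppath.unlock (insubT (is_path n) (in_corner_path hb)).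
by move/(fsubsetP msuppU_le); rewrite in_fset1 => /eqP ->.
Qed.

Lemma desc_loop i : (0 < i)%N -> desc [:: i; i.-1; i] = 1%N.
Proof. by rewrite /desc unlock /=; lia. Qed.

Lemma path_coef_neq0 s (g : pathalg k n) d : (forall p, p \in msupp g -> (pdeg p)%:Z = d) ->
  path_coef s g != 0 -> (desc s)%:Z = d.
Proof.
move=> hg; rewrite /path_coef; case: insubP => [p _ <-|]; last by rewrite eqxx.
by rewrite mcoeff_neq0 => /hg.
Qed.

(** The coordinate of a loop reads both (i|i+1|i) and (i|i-1|i), but each has degree 1. So every
    path read by a coordinate has the degree of its basis element. *)
Lemma zdeg_coord d (x : C) b : in_corner n b -> zdeg d x -> zcoord b x != 0 -> (bdeg b)%:Z = d.
Proof.
move=> hb [g hg ex]; rewrite (zcoord_pi hb ex) /qcoord.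
have h s := @path_coef_neq0 s g d hg.
have [e|/h //] := eqVneq (path_coef (word b) g) 0.
rewrite e add0r; case: b hb {e} => i hb; rewrite ?eqxx // => /h <-.
by rewrite desc_loop ?bdegE //; move: hb => /= ; lia.
Qed.

Lemma zdeg_sum (g : zz_basis -> C) d :
  (forall b, in_corner n b -> zdeg d (g b)) -> zdeg d (\sum_(b <- corner_basis n) g b).
Proof.
move=> hg; rewrite big_seq; apply: big_ind => [|x y|b].
- exact: zdeg0.
- exact: zdegD.
- by rewrite mem_corner_basis; apply: hg.
Qed.

Lemma zdeg_coord_scale d e (x y : C) b : in_corner n b -> zdeg d x ->
  ((bdeg b)%:Z = d -> zdeg e y) -> zdeg e (zcoord b x *: y).
Proof.
move=> hb hx hy; have [->|ne] := eqVneq (zcoord b x) 0; first by rewrite scale0r; apply: zdeg0.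
by apply/zdegZ/hy; apply: zdeg_coord ne.
Qed.

Lemma is_cochain_m3_map : is_cochain (-1) m3_map.
Proof.
split; [exact: multilinear_m3_map | exact: relative_m3_map | move=> t e he].
rewrite !big_ord_recl big_ord0 addr0 /m3_map.
(* Each argument contributes only basis elements of its own degree, which leaves the degree law of
   [m3_basisP]. *)
apply: zdeg_sum => a ha; apply: zdeg_coord_scale (he _) _ => // ea.
apply: zdeg_sum => b hb; apply: zdeg_coord_scale (he _) _ => // eb.
apply: zdeg_sum => c hc; apply: zdeg_coord_scale (he _) _ => // ec.
case f: (m3_basis a b c) => [d|]; last exact: zdeg0.
have [hd _ _ _ ed] := m3_basisP ha hb hc f.
suff <- : (bdeg d)%:Z = e ord0 + (e (lift ord0 ord0) + e (lift ord0 (lift ord0 ord0))) - 1.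
  exact: zdeg_bpath.
move: ea eb ec; rewrite (_ : o1 = lift ord0 ord0); last exact: val_inj.
rewrite (_ : ord_max = lift ord0 (lift ord0 ord0)); last exact: val_inj.
by move=> <- <- <-; lia.
Qed.

(** * Comparison of coefficients: m_3 is not a coboundary *)

Lemma zcoordMl c b b' y : in_corner n c -> in_corner n b -> in_corner n b' ->
  (forall d, (mul_basis c d == Some b) = (d == b')) -> zcoord b (bpath c * y) = zcoord b' y.
Proof.
(* By linearity only basis elements d matter, and by [h] the product of c and d is b exactly for d =
   b'. *)
move=> hc hb hb' h; elim/corner_basis_ind: y => [|a d y hd IH].
  by rewrite mulr0 !zcoord0.
rewrite mulrDr -zigzag_scalerAr !zcoordP // IH; congr (_ * _ + _).
rewrite bpathM // zcoord_bpath // eq_sym -h.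
case e: (mul_basis c d) => [x|] /=; last by rewrite zcoord0.
by rewrite zcoord_bpath ?(in_corner_mul _ _ e) // eq_sym.
Qed.

Lemma zcoordMr c b b' y : in_corner n c -> in_corner n b -> in_corner n b' ->
  (forall d, (mul_basis d c == Some b) = (d == b')) -> zcoord b (y * bpath c) = zcoord b' y.
Proof.
move=> hc hb hb' h; elim/corner_basis_ind: y => [|a d y hd IH].
  by rewrite mul0r !zcoord0.
rewrite mulrDl -zigzag_scalerAl !zcoordP // IH; congr (_ * _ + _).
rewrite bpathM // zcoord_bpath // eq_sym -h.
case e: (mul_basis d c) => [x|] /=; last by rewrite zcoord0.
by rewrite zcoord_bpath ?(in_corner_mul _ _ e) // eq_sym.
Qed.

Lemma multilinear2_0 (m : 2.-tuple C -> C) : multilinear m ->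
  (forall y, m [tuple 0; y] = 0) /\ (forall x, m [tuple x; 0] = 0).
Proof.
move=> mm; split=> [y|x].
  have := mm [tuple 0; y] ord0 (-1) 0 0; have [t1 _] := tset2 0 y.
  by rewrite !t1 scaler0 addr0 scaleN1r addNr.
have := mm [tuple x; 0] ord_max (-1) 0 0; have [_ t2] := tset2 x 0.
by rewrite !t2 scaler0 addr0 scaleN1r addNr.
Qed.

(** Running over the four shapes of t settles the uniqueness conditions of [zcoordMl] and [zcoordMr]
    for concrete factors. *)
Ltac mul_basis_inverse :=
  let t := fresh "t" in let i := fresh "i" in
  move=> t; apply/eqP/eqP => [|->//]; case: t => i //=; case: eqP => // <- //.

Lemma m3_map_not_coboundary (m : 2.-tuple C -> C) : (3 <= n)%N -> multilinear m ->
  hochd m <> m3_map.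
Proof.
move=> n3 mm e; have [m0l m0r] := multilinear2_0 mm.
have hv1 : in_corner n (Vtx 1) by rewrite /=; lia.
have hv2 : in_corner n (Vtx 2) by rewrite /=; lia.
have hu : in_corner n (Up 1) by rewrite /=; lia.
have hd : in_corner n (Down 1) by rewrite /=; lia.
have hl1 : in_corner n (Loop 1) by rewrite /=; lia.
have hl2 : in_corner n (Loop 2) by rewrite /=; lia.
have one b : in_corner n b -> zcoord b (bpath b) = 1 by move=> hb; rewrite zcoord_bpath // eqxx.
(* The b-coordinate of (delta m)(x, y, z), where c (resp. d) is the only basis
   element with x c = b (resp. d z = b). *)
have E b c d x y z r : in_corner n x -> in_corner n y -> in_corner n z ->
   in_corner n b -> in_corner n c -> in_corner n d ->
  (forall t, (mul_basis x t == Some b) = (t == c)) ->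
  (forall t, (mul_basis t z == Some b) = (t == d)) ->
  zcoord b (opath (m3_basis x y z)) = r ->
  zcoord c (m [tuple bpath y; bpath z]) - zcoord b (m [tuple opath (mul_basis x y); bpath z])
  + zcoord b (m [tuple bpath x; opath (mul_basis y z)]) - zcoord d (m [tuple bpath x; bpath y]) = r.
  move=> hx hy hz hb hc hdd h1 h2 <-.
  have := congr1 (fun f => zcoord b (f [tuple bpath x; bpath y; bpath z])) e.
  rewrite hochd2E m3_mapE m3_lin_bpath // !bpathM // => <-.
  by rewrite zcoordB // zcoordD // zcoordB // (zcoordMl _ hx hb hc) // (zcoordMr _ hz hb hdd).
(* In order, the six triples are (u,d,u), (d,u,d), (u,d,l), (l',d,u), (l,u,d), (d,u,l'). The
   right-hand side is 1 exactly for those on which a rule of m_3 applies. *)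
have e1 := E (Up 1) (Vtx 2) (Vtx 1) (Up 1) (Down 1) (Up 1) 1 hu hd hu hu hv2 hv1
  ltac:(mul_basis_inverse) ltac:(mul_basis_inverse) (one _ hu).
have e2 := E (Down 1) (Vtx 1) (Vtx 2) (Down 1) (Up 1) (Down 1) 0 hd hu hd hd hv1 hv2
  ltac:(mul_basis_inverse) ltac:(mul_basis_inverse) (zcoord0 k hd).
have e3 := E (Loop 1) (Down 1) (Vtx 1) (Up 1) (Down 1) (Loop 1) 1 hu hd hl1 hl1 hd hv1
  ltac:(mul_basis_inverse) ltac:(mul_basis_inverse) (one _ hl1).
have e4 := E (Loop 2) (Vtx 2) (Down 1) (Loop 2) (Down 1) (Up 1) 1 hl2 hd hu hl2 hv2 hd
  ltac:(mul_basis_inverse) ltac:(mul_basis_inverse) (one _ hl2).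
have e5 := E (Loop 1) (Vtx 1) (Up 1) (Loop 1) (Up 1) (Down 1) 0 hl1 hu hd hl1 hv1 hu
  ltac:(mul_basis_inverse) ltac:(mul_basis_inverse) (zcoord0 k hl1).
have e6 := E (Loop 2) (Up 1) (Vtx 2) (Down 1) (Up 1) (Loop 2) 0 hd hu hl2 hl2 hu hv2
  ltac:(mul_basis_inverse) ltac:(mul_basis_inverse) (zcoord0 k hl2).
(* The products dl, l'd, lu and ul' are zero, so each of [e3] to [e6] loses one term. *)
rewrite /= ?m0l ?m0r ?(zcoord0 k hd) ?(zcoord0 k hl1) ?(zcoord0 k hl2) in e1 e2 e3 e4 e5 e6.
rewrite ?subr0 ?addr0 in e1 e2 e3 e4 e5 e6.
have /eqP := oner_neq0 k; apply.
(* In this signed combination all values of m cancel, in any characteristic. *)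
transitivity ((1 + 1 + 0 + 0) - (1 + 0) : k); first by ring.
(* Each rewrite replaces the first remaining matching constant, so [e3] to [e6] enter with sign plus
   and [e1], [e2] with sign minus. *)
by rewrite -{1}e3 -{1}e4 -{1}e5 -{1}e6 -{1}e1 -{1}e2; ring.
Qed.

End Main.

Theorem mainTheorem5 (k : fieldType) (n : nat)
    (char2 : 2%N \in [pchar k]) (n_ge4 : (4 <= n)%N) :
  (exists! m3 : 3.-tuple (zigzag k n) -> zigzag k n, is_m3 m3) /\
  (forall m3 : 3.-tuple (zigzag k n) -> zigzag k n, is_m3 m3 ->
     ~ (exists2 m : 2.-tuple (zigzag k n) -> zigzag k n,
          is_cochain (-1) m & hochd m = m3) /\
     (exists2 z : cocycle k n 3 (-1),
        cocycle_val z = m3 & hh_class z != 0)).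
Proof.
have not_cob : ~ (exists2 m : 2.-tuple (zigzag k n) -> zigzag k n,
    is_cochain (-1) m & hochd m = m3_map (n := n)).
  by case=> m [mm _ _]; apply: m3_map_not_coboundary mm; apply: ltnW.
split.
  exists (@m3_map k n); split; first exact: is_m3_m3_map.
  by move=> m hm; rewrite (is_m3_unique hm).
(* Uniqueness replaces the given map by [m3_map], whose class can vanish only if it is a
   coboundary. *)
move=> m /is_m3_unique ->; split=> //.
have cocm : @m3_map k n \in @cocycles k n 3 (-1).
  by apply/asboolP; split; [exact: is_cochain_m3_map | exact: hochd_m3_map].
exists (Cocycle cocm) => //; apply/eqP => /hh_class_eq0; exact: not_cob.
Qed.
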